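(* $\mathsf{DSym}\in\mathsf{dMAMAM}[O(\log\log n)]$, where in $\mathsf{DSym}$ a fixed permutation $\pi$ of the vertex set $V$ of the $n$-node communication graph $G=(V,E)$ is known to all nodes, and the instance is in the language iff $\pi$ is an automorphism of $G$, i.e. $(u,v)\in E\iff(\pi(u),\pi(v))\in E$ for all $u,v\in V$.
   Context: Distributed interactive proofs (model). An instance consists of a connected communication graph $G=(V,E)$ with $|V|=n$, where each node has a unique identifier of $O(\log n)$ bits, knows $n$, knows its own identifier, its local input (if the problem has local inputs), and the identifiers of its neighbours (with an arbitrary port numbering of its incident edges). A prover, who sees the whole instance, interacts with all nodes in $r$ alternating messages. In a verifier (node) message each node independently samples fresh uniformly random bits and sends them to the prover (public coins). In a prover message the prover sends each node a string. Nodes may additionally exchange the strings they received from the prover with their neighbours in $G$. At the end each node deterministically accepts or rejects as a function of its local information, its own random bits, the strings it received from the prover and those its neighbours received; the instance is accepted iff all nodes accept. The proof size is the maximum number of bits in any single message between the prover and any node. A language $\mathcal L$ (set of instances) is in $\mathsf{dIP}[r,\ell]$ if there is an $r$-message protocol of proof size $\ell=\ell(n)$ such that (completeness) for every instance in $\mathcal L$ some prover makes all nodes accept with probability $>2/3$, and (soundness) for every instance not in $\mathcal L$ and every prover, all nodes accept with probability $<1/3$ (probabilities over the nodes' coins). $\mathsf{dAM}[\ell]$, $\mathsf{dMAM}[\ell]$, $\mathsf{dAMAM}[\ell]$, $\mathsf{dMAMAM}[\ell]$ denote the cases of 2, 3, 4, 5 messages, where the letters indicate who sends each message in order (A = nodes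 send random coins, M = prover). *)

(* Defs.v *)
From HB Require Import structures.
From mathcomp Require Import all_boot all_fingroup.
Set Implicit Arguments. Unset Strict Implicit. Unset Printing Implicit Defensive.

(* An instance on n nodes (internally indexed by 'I_n; the index is NOT visible
   to the nodes).  [ids] = unique identifiers, [ports] = the port numbering
   (neighbours listed in port order), [perm_in] = the permutation pi of V. *)
Record instance (n : nat) := Instance {
  adj : rel 'I_n;
  ids : 'I_n -> nat;
  ports : 'I_n -> seq 'I_n;
  perm_in : {perm 'I_n} }.

Definition valid_instance (c n : nat) (I : instance n) : Prop :=
  0 < n /\ symmetric (adj I) /\ irreflexive (adj I) /\
  (forall u v, connect (adj I) u v) /\
  injective (ids I) /\ (forall v, ids I v < n ^ c) /\
  (forall v, perm_eq (ports I v) [seq u <- enum 'I_n | adj I v u]).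

Definition DSym (n : nat) (I : instance n) : Prop :=
  forall u v, adj I u v = adj I (perm_in I u) (perm_in I v).

Definition pi_on_ids (n : nat) (I : instance n) : nat -> option nat :=
  fun x => omap (fun v => ids I (perm_in I v)) [pick v | ids I v == x].

(* A (uniform) protocol: proof-size function [ell] and the deterministic
   decision of a node, given: n, its own id, pi (on ids), its neighbours' ids
   in port order, its own coins of rounds 1 and 2, its own three prover
   strings, and its neighbours' three prover strings (in port order). *)
Record protocol := Protocol {
  ell : nat -> nat;
  decide : nat -> nat -> (nat -> option nat) -> seq nat ->
           bitseq -> bitseq -> (bitseq * bitseq * bitseq) ->
           seq (bitseq * bitseq * bitseq) -> bool }.

Notation coins n L := {ffun 'I_n -> L.-tuple bool}.

Record prover5 (n L : nat) := Prover5 {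
  pm1 : 'I_n -> bitseq;
  pm2 : coins n L -> 'I_n -> bitseq;
  pm3 : coins n L -> coins n L -> 'I_n -> bitseq }.

Definition prover_size_ok (n L : nat) (Pr : prover5 n L) : Prop :=
  forall (c1 c2 : coins n L) (v : 'I_n),
    [/\ size (pm1 Pr v) <= L, size (pm2 Pr c1 v) <= L & size (pm3 Pr c1 c2 v) <= L].

Definition node_accepts (P : protocol) (n : nat) (I : instance n)
    (Pr : prover5 n (ell P n)) (c1 c2 : coins n (ell P n)) (v : 'I_n) : bool :=
  let s u := (pm1 Pr u, pm2 Pr c1 u, pm3 Pr c1 c2 u) in
  decide P n (ids I v) (pi_on_ids I) [seq ids I u | u <- ports I v]
         (val (c1 v)) (val (c2 v)) (s v) [seq s u | u <- ports I v].

Definition n_accept (P : protocol) (n : nat) (I : instance n)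
    (Pr : prover5 n (ell P n)) : nat :=
  #|[set cc : coins n (ell P n) * coins n (ell P n)
       | [forall v, node_accepts I Pr cc.1 cc.2 v]]|.

Definition n_total (n L : nat) : nat := #|{: coins n L * coins n L}|.

Definition decides_dMAMAM (c : nat) (P : protocol)
    (lang : forall n, instance n -> Prop) : Prop :=
  forall (n : nat) (I : instance n), valid_instance c I ->
    (lang n I -> exists Pr : prover5 n (ell P n),
        prover_size_ok Pr /\ 2 * n_total n (ell P n) < 3 * n_accept I Pr) /\
    (~ lang n I -> forall Pr : prover5 n (ell P n),
        3 * n_accept I Pr < n_total n (ell P n)).

(* Main.v *)
(** Every node knows [pi] on identifiers, hence the set of all identifiers, so it
    knows its own rank in [0, n) and that of its image.  Put [m = up_log 2 n].

    Round 1: the node of rank [k < m] draws [z1 k, z2 k] of size polylog(n), and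
    [z k = z1 k + B * z2 k] for a large radix [B].  An index [i] in [0, 2 ^ m) is
    coded by [g i = sum_k (M +- z k)], the sign being the [k]-th bit of [i]; the
    two base-[B] digits of [g] are the codes [g1], [g2] built from [z1], [z2].
    By Schwartz-Zippel, [sum_(u,v) D(u,v) X^(g1 u + B * g2 v)] is a nonzero
    polynomial for most seeds as soon as [D] is nonzero; it is applied to the
    difference [D] between the adjacency matrix and its conjugate by [pi].

    The prover answers with [g u] and [g (pi u)] at each node [u]; no node knows
    enough seeds to check this.  However a claim vector [a] is equal to [g] iff
    the integer [sum_i (a i - g i)^2] vanishes, and, the bit characters being
    orthogonal on the cube, this follows from [sum_i y_i^2 = 2^m sum_k z_k^2] and
    the [m] correlations [sum_i y_i (+-1) = 2^m z_k], with [y = a - m M].  In round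
    2 the node of rank 0 draws a prime [p] of size polylog(n), which most likely
    does not divide that integer, a point [t] at which the correlations are merged
    into one polynomial identity, and a point [w] at which the fingerprint
    polynomial is evaluated.

    All that remains are identities [sum_v f_v = 0] in F_p with [f_v] known to
    [v].  They are proved by a flow: each node exchanges with each neighbour an
    amount determined by their two labels, so any labelling balancing every node
    forces the sum to vanish.  Short labels cannot designate one parent among many
    neighbours, so in an honest proof a node splits its flow evenly among the
    neighbours of one colour in the previous breadth-first layer; a colouring
    exists for which the number of these neighbours is not divisible by [p]. *)

Require Import Defs.
From HB Require Import structures.
From mathcomp Require Import all_boot all_fingroup.
From mathcomp Require Import all_algebra.
From mathcomp Require Import zify ring.
Set Implicit Arguments. Unset Strict Implicit. Unset Printing Implicit Defensive.

(** * Bit strings and independent coins *)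

Definition nat_of_bits (s : bitseq) : nat :=
  foldr (fun (b : bool) acc => b + acc.*2) 0 s.

Definition bits_of_nat (w x : nat) : bitseq :=
  mkseq (fun k => odd (x %/ 2 ^ k)) w.

Lemma nat_of_bits_lt s : nat_of_bits s < 2 ^ size s.
Proof. elim: s => //= b s IH; rewrite expnS; case: b; lia. Qed.

Lemma bits_of_natS w x : bits_of_nat w.+1 x = odd x :: bits_of_nat w x./2.
Proof.
rewrite /bits_of_nat /mkseq /= divn1; congr (_ :: _).
rewrite (iotaDl 1 0) -map_comp; apply: eq_map => k /=.
by rewrite add1n expnS divnMA divn2.
Qed.

Lemma bits_of_natK w x : x < 2 ^ w -> nat_of_bits (bits_of_nat w x) = x.
Proof.
elim: w x => [|w IH] x; first by rewrite expn0; case: x.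
rewrite bits_of_natS expnS => lx /=; rewrite IH ?odd_double_half //.
by have := odd_double_half x; lia.
Qed.

Lemma nat_of_bitsK w s : size s = w -> bits_of_nat w (nat_of_bits s) = s.
Proof.
move=> <-; elim: s => //= b s IH; rewrite bits_of_natS.
rewrite oddD odd_double addbF oddb; congr (_ :: _).
by rewrite halfD odd_double andbF add0n doubleK; case: b.
Qed.

Lemma size_bits_of_nat w x : size (bits_of_nat w x) = w.
Proof. exact: size_mkseq. Qed.

Definition field_at (w : nat) (s : bitseq) (k : nat) : nat :=
  nat_of_bits (take w (drop (k * w) s)).

Definition pack (w : nat) (xs : seq nat) : bitseq :=
  flatten [seq bits_of_nat w x | x <- xs].

Lemma size_pack w xs : size (pack w xs) = size xs * w.
Proof. by elim: xs => //= x xs IH; rewrite size_cat size_bits_of_nat IH mulSn. Qed.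

Lemma field_pack w xs k :
  all (fun x => x < 2 ^ w) xs -> field_at w (pack w xs) k = nth 0 xs k.
Proof.
rewrite /field_at; elim: xs k => [|x xs IH] k /=.
  by rewrite nth_nil.
case/andP=> lx /IH {}IH; case: k => [|k] /=.
  rewrite mul0n drop0 take_size_cat ?size_bits_of_nat //; exact: bits_of_natK.
by rewrite mulSn drop_cat size_bits_of_nat ltnNge leq_addr /= addKn; apply: IH.
Qed.

Lemma field_at_lt w s k : field_at w s k < 2 ^ w.
Proof.
apply: leq_trans (nat_of_bits_lt _) _; rewrite leq_exp2l // size_take_min.
exact: geq_minl.
Qed.

Definition slice (o a : nat) (s : bitseq) : nat := nat_of_bits (take a (drop o s)).

Lemma slice_lt o a s : slice o a s < 2 ^ a.
Proof.
apply: leq_trans (nat_of_bits_lt _) _; rewrite leq_exp2l // size_take_min.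
exact: geq_minl.
Qed.

(** Paired with [slice] this forms a lens on coin strings; the laws below are those that
    [lens_count] asks for. *)
Definition set_slice (o a : nat) (s : bitseq) (x : nat) : bitseq :=
  take o s ++ bits_of_nat a x ++ drop (o + a) s.

Section SetSlice.
Variables (o a : nat) (s : bitseq).
Hypothesis oas : o + a <= size s.

Lemma size_set_slice x : size (set_slice o a s x) = size s.
Proof.
rewrite /set_slice !size_cat size_bits_of_nat size_drop size_takel; lia.
Qed.

Lemma slice_set x : x < 2 ^ a -> slice o a (set_slice o a s x) = x.
Proof.
move=> lx; rewrite /slice /set_slice drop_size_cat ?size_takel; last lia.
  by rewrite take_size_cat ?size_bits_of_nat // bits_of_natK.
lia.
Qed.

Lemma set_slice_set x y :
  set_slice o a (set_slice o a s x) y = set_slice o a s y.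
Proof.
rewrite {1}/set_slice; congr (_ ++ (_ ++ _)).
  by rewrite /set_slice take_size_cat // size_takel //; lia.
rewrite /set_slice catA drop_size_cat // size_cat size_bits_of_nat size_takel //.
lia.
Qed.

Lemma set_slice_id : set_slice o a s (slice o a s) = s.
Proof.
rewrite /set_slice /slice nat_of_bitsK; last by rewrite size_takel // size_drop; lia.
by rewrite addnC -drop_drop !cat_take_drop.
Qed.

Lemma slice_set_other o' a' x :
  (o' + a' <= o) || (o + a <= o') ->
  slice o' a' (set_slice o a s x) = slice o' a' s.
Proof.
move=> dis; rewrite /slice; congr nat_of_bits.
apply: (@eq_from_nth _ false) => [|i].
  by rewrite !size_take_min !size_drop size_set_slice.
rewrite size_take_min size_drop size_set_slice => li.
rewrite !nth_take ?nth_drop; try lia.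
rewrite /set_slice nth_cat size_takel; last lia.
case: ifP => h1; first by rewrite nth_take.
rewrite nth_cat size_bits_of_nat ifF; last lia.
by rewrite nth_drop; congr nth; lia.
Qed.
End SetSlice.

(* Swapping the stored value with an independent fresh one is an involution of [O * A]. *)
Lemma lens_count (O A : finType) (get : O -> A) (set : O -> A -> O)
    (E : O -> A -> bool) (k : nat) :
  (forall c x, get (set c x) = x) ->
  (forall c x y, set (set c x) y = set c y) ->
  (forall c, set c (get c) = c) ->
  (forall c x y, E (set c x) y = E c y) ->
  (forall c, #|[set x | E c x]| <= k) ->
  #|[set c | E c (get c)]| * #|A| <= k * #|O|.
Proof.
move=> gs ss sg Es Ek.
pose h (z : O * A) := (set z.1 z.2, get z.1).
have hK : involutive h by move=> [c x]; rewrite /h /= ss sg gs.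
rewrite -[#|A|]cardsT -cardsX -(card_imset _ (inv_inj hK)).
have sub : h @: setX [set c | E c (get c)] setT \subset [set z | E z.1 z.2].
  apply/subsetP=> _ /imsetP [[c x] /setXP [/[!inE] Ec _] ->] /=.
  by rewrite Es.
apply: leq_trans (subset_leq_card sub) _.
rewrite -sum1dep_card -(pair_big_dep xpredT (fun c x => E c x) (fun _ _ => 1)) /=.
rewrite mulnC -sum_nat_const; apply: leq_sum => c _.
by rewrite sum1dep_card.
Qed.

(** * Primes below a power of two *)

Lemma central_bin_ge k : 2 ^ k <= 'C(2 * k, k).
Proof.
elim: k => [|k IH]; first by rewrite bin0.
have -> : 2 * k.+1 = (2 * k).+2 by lia.
have h := @leq_bin2l (2 * k) (2 * k).+1 k (leqnSn _).
by rewrite expnS binS (binS _ k); lia.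
Qed.

(** By Legendre's formula the exponent is the sum over [i] of [(2 * k) %/ p ^ i] minus twice
    [k %/ p ^ i]. Each difference is at most 1 and vanishes once [p ^ i] exceeds [2 * k]. The
    [maxn 1] covers [k = 0]. *)
Lemma logn_central_bin p k : prime p -> p ^ logn p 'C(2 * k, k) <= maxn 1 (2 * k).
Proof.
move=> pp; case: k => [|k]; first by rewrite bin0 logn1.
set K := k.+1; have p1 := prime_gt1 pp.
have K0 : 0 < 2 * K by rewrite /K; lia.
suff H : logn p 'C(2 * K, K) <= trunc_log p (2 * K).
  rewrite leq_max; apply/orP; right.
  by apply: leq_trans (trunc_logP p1 K0); rewrite leq_exp2l.
have ext : \sum_(1 <= i < K.+1) K %/ p ^ i = \sum_(1 <= i < (2 * K).+1) K %/ p ^ i.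
  rewrite (@big_cat_nat _ _ _ K.+1 1 (2 * K).+1) //=; try lia.
  rewrite [X in _ = _ + X]big1_seq ?addn0 // => i /andP[_]; rewrite mem_index_iota => hi.
  by rewrite divn_small // (ltn_trans _ (ltn_expl i p1)) //; lia.
have E : logn p 'C(2 * K, K) + (\sum_(1 <= i < (2 * K).+1) K %/ p ^ i).*2
         = \sum_(1 <= i < (2 * K).+1) (2 * K) %/ p ^ i.
  rewrite -logn_fact // -ext -logn_fact //.
  have H := @bin_fact (2 * K) K ltac:(lia).
  rewrite -H lognM ?fact_gt0 ?bin_gt0 ?muln_gt0 ?fact_gt0 //; last lia.
  have -> : 2 * K - K = K by lia.
  by rewrite lognM ?fact_gt0 // addnn.
have B : \sum_(1 <= i < (2 * K).+1) (2 * K) %/ p ^ i <=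
   (\sum_(1 <= i < (2 * K).+1) K %/ p ^ i).*2
     + \sum_(1 <= i < (2 * K).+1) (p ^ i <= 2 * K).
  rewrite -mul2n big_distrr -big_split /=; apply: leq_sum => i _.
  have q0 : 0 < p ^ i by rewrite expn_gt0 (prime_gt0 pp).
  case: (leqP (p ^ i) (2 * K)) => h; last by rewrite divn_small.
  rewrite -ltnS ltn_divLR //.
  have := divn_eq K (p ^ i); have := @ltn_pmod K _ q0; nia.
have C : \sum_(1 <= i < (2 * K).+1) (p ^ i <= 2 * K) <= trunc_log p (2 * K).
  set t := trunc_log _ _.
  have tK : t < (2 * K).+1.
    rewrite ltnS; apply: leq_trans (trunc_logP p1 K0).
    exact: ltnW (ltn_expl _ p1).
  rewrite (@big_cat_nat _ _ _ t.+1) //=.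
  rewrite [X in _ + X]big1_seq ?addn0 => [|i /andP[_]].
    apply: leq_trans (_ : \sum_(1 <= i < t.+1) 1 <= _).
      by apply: leq_sum => i _; apply: leq_b1.
    by rewrite sum_nat_const_nat muln1 subn1.
  rewrite mem_index_iota => /andP[ti _]; apply/eqP; rewrite eqb0 -ltnNge.
  apply: leq_trans (trunc_log_ltn _ p1) _; by rewrite leq_exp2l.
lia.
Qed.

(* Chebyshev: each prime contributes a factor at most [2 k] to the binomial coefficient ['C(2 * k, k)], which is at least [2 ^ k]. *)
Lemma primes_lower_bound y : 2 ^ y <= y.+1 * count prime (iota 0 (2 ^ y.+1).+1).
Proof.
set k := 2 ^ y; have k0 : 0 < k by rewrite expn_gt0.
have k2 : 2 ^ y.+1 = 2 * k by rewrite expnS.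
rewrite k2; set c := count _ _.
suff H : 'C(2 * k, k) <= (2 * k) ^ c.
  have := leq_trans (central_bin_ge k) H.
  by rewrite -k2 -expnM leq_exp2l.
set C := 'C(_, _); have C0 : 0 < C by rewrite bin_gt0; lia.
rewrite -(partnT C0) (@widen_partn (maxn C (2 * k))); last by rewrite leq_maxl.
set M := maxn _ _.
rewrite (@big_cat_nat _ _ _ (2 * k).+1) //=; last by rewrite ltnS leq_maxr.
have le_p p : p ^ logn p C <= if prime p then 2 * k else 1.
  case: ifP => pp; last by rewrite lognE pp.
  by apply: leq_trans (logn_central_bin k pp) _; rewrite geq_max; lia.
rewrite [X in _ * X]big1_seq ?muln1; last first.
  move=> p /andP[_]; rewrite mem_index_iota => /andP[lp _].
  case: (boolP (prime p)) => pp; last by rewrite lognE (negbTE pp).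
  have [->//|l0] := posnP (logn p C).
  have := logn_central_bin k pp; rewrite -/C => h.
  have : p ^ 1 <= p ^ logn p C by rewrite leq_exp2l // prime_gt1.
  lia.
apply: leq_trans (_ : \prod_(0 <= p < (2 * k).+1) (if prime p then 2 * k else 1) <= _).
  by apply: leq_prod.
rewrite -big_mkcond /= big_const_seq /index_iota subn0 -/c.
by rewrite -Monoid.iteropE.
Qed.

Definition primes_in (X Y : nat) : seq nat := [seq p <- iota X (Y - X) | prime p].

Lemma mem_primes_in X Y p : X <= Y ->
  (p \in primes_in X Y) = [&& prime p, X <= p & p < Y].
Proof. by move=> XY; rewrite mem_filter mem_iota subnKC. Qed.

Lemma uniq_primes_in X Y : uniq (primes_in X Y).
Proof. exact/filter_uniq/iota_uniq. Qed.

(** Chebyshev's bound gives at least [2 * 2 ^ a] primes up to [2 ^ (2 * a)], since [8 * a <= 2 ^ a]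
    from [a = 6] on; at most [2 ^ a] of them are below [2 ^ a]. *)
Lemma size_primes_in a : 6 <= a -> 2 ^ a <= size (primes_in (2 ^ a) (2 ^ (2 * a))).
Proof.
move=> a6; rewrite size_filter.
have aE : 2 * a = ((2 * a).-1).+1 by lia.
have := primes_lower_bound (2 * a).-1; rewrite -aE.
set A := 2 ^ a; set B := 2 ^ (2 * a).
have BE : B = A * A by rewrite /B mul2n -addnn expnD.
have A8 : 8 * a <= A.
  rewrite /A; elim: a a6 {aE A B BE} => // a IH a6.
  have [a5|a5] := eqVneq a 5; first by rewrite a5.
  by have := IH ltac:(lia); rewrite expnS; lia.
have B2 : 2 * 2 ^ (2 * a).-1 = B by rewrite -expnS -aE.
have -> : B.+1 = A + ((B - A) + 1) by nia.
rewrite !iotaD !count_cat add0n.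
have c1 : count prime (iota 0 A) <= A by rewrite -{2}(size_iota 0 A) count_size.
set x := count prime (iota A _).
(* The Chebyshev count includes the endpoint [B], which is composite, being the square of [A]. *)
have -> : count prime (iota (A + (B - A)) 1) = 0.
  have -> : A + (B - A) = B by nia.
  rewrite /= addn0; apply/eqP; rewrite eqb0; apply/negP => pB.
  have : A %| B by rewrite BE dvdn_mulr.
  move/primeP: pB => [_ H] /H /orP [] /eqP e; clear -a6 A8 BE e; nia.
move=> h; rewrite leqNgt; apply/negP => xA; nia.
Qed.

(** Distinct primes dividing [Q] are coprime, so their product divides [Q], and each is at least
    2. *)
Lemma count_prime_divisors s Q : uniq s -> all prime s -> 0 < Q ->
  2 ^ count (fun p => p %| Q) s <= Q.
Proof.
move=> us /allP ps Q0; rewrite -size_filter; set t := filter _ _.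
have ut : uniq t by apply: filter_uniq.
have pt p : p \in t -> prime p /\ p %| Q by rewrite mem_filter => /andP[? /ps].
suff [H1 H2] : 2 ^ size t <= \prod_(p <- t) p /\ \prod_(p <- t) p %| Q.
  by apply: leq_trans H1 _; apply: dvdn_leq.
elim: (t) ut pt => [|p r IH] /=; first by rewrite big_nil dvd1n.
case/andP => pr ur H; have [] := IH ur (fun q qr => H q (mem_behead (s := p :: r) qr)).
have [pp pQ] := H p (mem_head _ _); rewrite big_cons expnS => h1 h2; split.
  by apply: leq_mul => //; apply: prime_gt1.
rewrite Gauss_dvd ?pQ //.
rewrite big_seq; elim/big_rec: _ => [|q x qr cx]; first exact: coprimen1.
have [pq _] := H q (mem_behead (s := p :: r) qr).
rewrite coprimeMr cx andbT prime_coprime // dvdn_prime2 //.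
by apply: contraNneq pr => ->.
Qed.

(** * Walsh characters and claim vectors *)

Section Walsh.
Import GRing.Theory.
Local Open Scope ring_scope.

Definition bit (k i : nat) : bool := odd (i %/ 2 ^ k)%N.

Lemma bit_addX k m i : (k < m)%N -> bit k (2 ^ m + i)%N = bit k i.
Proof.
move=> km; rewrite /bit.
have -> : (2 ^ m = 2 ^ (m - k) * 2 ^ k)%N by rewrite -expnD subnK // ltnW.
by rewrite divnMDl ?expn_gt0 // oddD oddX subn_eq0 leqNgt km.
Qed.

Lemma bit_small m i : (i < 2 ^ m)%N -> bit m i = false.
Proof. by move=> im; rewrite /bit divn_small. Qed.

Lemma bit_top m i : (i < 2 ^ m)%N -> bit m (2 ^ m + i)%N = true.
Proof. by move=> im; rewrite /bit -{1}[(2 ^ m)%N]mul1n divnMDl ?expn_gt0 // divn_small. Qed.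

Lemma sum_pow2S (V : nmodType) m (F : nat -> V) :
  \sum_(i < 2 ^ m.+1) F i = \sum_(i < 2 ^ m) F i + \sum_(i < 2 ^ m) F (2 ^ m + i)%N.
Proof.
by rewrite expnS mul2n -addnn big_split_ord.
Qed.

(** A function on the cube whose Fourier expansion has only the [m] characters of single bits, with
    coefficients [z]. *)
Definition walsh (R : pzRingType) (m : nat) (z : nat -> R) (i : nat) : R :=
  \sum_(k < m) (-1) ^+ bit k i * z k.

Lemma walsh_low (R : pzRingType) m (z : nat -> R) i :
  (i < 2 ^ m)%N -> walsh m.+1 z i = walsh m z i + z m.
Proof. by move=> im; rewrite /walsh big_ord_recr /= bit_small // mul1r. Qed.

Lemma walsh_high (R : pzRingType) m (z : nat -> R) i :
  (i < 2 ^ m)%N -> walsh m.+1 z (2 ^ m + i)%N = walsh m z i - z m.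
Proof.
move=> im; rewrite /walsh big_ord_recr /= bit_top // mulN1r; congr (_ - _).
by apply: eq_bigr => k _; rewrite bit_addX.
Qed.

(** Induction on the dimension: the two halves of the cube contribute
    [(A + z)(B + t) + (A - z)(B - t)], in which the mixed terms cancel. *)
Lemma walsh_parseval (R : comPzRingType) m (z t : nat -> R) :
  \sum_(i < 2 ^ m) walsh m z i * walsh m t i = (2 ^ m)%:R * \sum_(k < m) z k * t k.
Proof.
elim: m => [|m IH].
  by rewrite expn0 big_ord1 /walsh !big_ord0 !mulr0.
rewrite (sum_pow2S m (fun i => walsh m.+1 z i * walsh m.+1 t i)) -big_split /=.
have -> : \sum_(i < 2 ^ m)
     (walsh m.+1 z i * walsh m.+1 t i
      + walsh m.+1 z (2 ^ m + i)%N * walsh m.+1 t (2 ^ m + i)%N)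
   = \sum_(i < 2 ^ m) ((walsh m z i * walsh m t i) *+ 2 + (z m * t m) *+ 2).
  apply: eq_bigr => i _; rewrite !walsh_high // !walsh_low //; ring.
rewrite big_split /= sumr_const card_ord sumrMnl IH big_ord_recr /=.
rewrite expnS natrM; ring.
Qed.

(** Expanding the square, the correlations determine the cross term and Parseval the last one; all
    three terms are multiples of the same quantity and cancel. Over a finite field a vanishing sum
    of squares does not make [y] equal to [walsh m z], so the conclusion stops at the sum. *)
Lemma walsh_rigid (R : comPzRingType) m (y z : nat -> R) :
  \sum_(i < 2 ^ m) y i ^+ 2 = (2 ^ m)%:R * \sum_(k < m) z k ^+ 2 ->
  (forall k, (k < m)%N -> \sum_(i < 2 ^ m) y i * (-1) ^+ bit k i = (2 ^ m)%:R * z k) ->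
  \sum_(i < 2 ^ m) (y i - walsh m z i) ^+ 2 = 0.
Proof.
move=> norm corr.
have cross : \sum_(i < 2 ^ m) y i * walsh m z i = (2 ^ m)%:R * \sum_(k < m) z k ^+ 2.
  under eq_bigr do rewrite /walsh big_distrr /=.
  rewrite exchange_big /= big_distrr /=; apply: eq_bigr => k _.
  rewrite expr2 mulrA -corr // big_distrl /=; apply: eq_bigr => i _; ring.
have self := walsh_parseval m z z.
have -> : \sum_(i < 2 ^ m) (y i - walsh m z i) ^+ 2
  = \sum_(i < 2 ^ m) y i ^+ 2 - (\sum_(i < 2 ^ m) y i * walsh m z i) *+ 2
    + \sum_(i < 2 ^ m) walsh m z i * walsh m z i.
  rewrite -sumrMnl -sumrB -big_split /=; apply: eq_bigr => i _; ring.
rewrite self norm cross; under [in X in _ + X]eq_bigr do rewrite -expr2; ring.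
Qed.

(** The Walsh sum shifted by [m * M], so that it is a natural number, usable as an exponent,
    whenever the seeds are at most [M]. *)
Definition weight (m M : nat) (z : nat -> nat) (i : nat) : nat :=
  (\sum_(k < m) (if bit k i then M - z k else M + z k))%N.

Lemma weightE (R : pzRingType) m M z i : (forall k, z k <= M)%N ->
  (weight m M z i)%:R = (m * M)%:R + walsh m (fun k => (z k)%:R : R) i.
Proof.
move=> zM; rewrite /weight /walsh natr_sum.
have -> : (m * M)%:R = \sum_(k < m) M%:R :> R.
  by rewrite sumr_const card_ord mulnC natrM mulr_natr.
rewrite -big_split /=; apply: eq_bigr => k _; case: (bit _ _).
  by rewrite natrB // mulN1r.
by rewrite natrD mul1r.
Qed.

(** Taken over the integers, where its vanishing forces equality; its residue modulo a prime is what
    the nodes can test. The [maxn] and [minn] avoid truncated subtraction. *)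
Definition sq_dist (m : nat) (a g : nat -> nat) : nat :=
  (\sum_(i < 2 ^ m) (maxn (a i) (g i) - minn (a i) (g i)) ^ 2)%N.

Lemma sq_distE (R : comPzRingType) m (a g : nat -> nat) :
  (sq_dist m a g)%:R = \sum_(i < 2 ^ m) ((a i)%:R - (g i)%:R) ^+ 2 :> R.
Proof.
rewrite /sq_dist natr_sum; apply: eq_bigr => i _; rewrite natrX.
have [h|h] := leqP (a i) (g i); last by rewrite natrB // ltnW.
by rewrite natrB // -sqrrN opprB.
Qed.

Lemma sq_dist_eq0 m a g i : sq_dist m a g = 0%N -> (i < 2 ^ m)%N -> a i = g i.
Proof.
move/eqP; rewrite /sq_dist sum_nat_eq0 => /forallP H im.
by have := H (Ordinal im); rewrite /= expn_eq0 /=; lia.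
Qed.

Lemma sq_dist_bound m a g w :
  (forall i, a i < 2 ^ w)%N -> (forall i, g i < 2 ^ w)%N ->
  (sq_dist m a g <= 2 ^ (m + w + w))%N.
Proof.
move=> aw gw; rewrite -addnA expnD /sq_dist.
apply: leq_trans (_ : (\sum_(i < 2 ^ m) 2 ^ (w + w) <= _)%N).
  apply: leq_sum => i _; rewrite addnn -muln2 expnM leq_exp2r //.
  by have := aw i; have := gw i; lia.
by rewrite sum_nat_const card_ord.
Qed.

(** The second test is the combination of the [m] correlation identities with weights [t ^ k]. *)
Definition claim_ok (p m M : nat) (z a : nat -> nat) (t : nat) : bool :=
  let y i := (a i)%:R - (m * M)%:R : 'F_p in
  (\sum_(i < 2 ^ m) y i ^+ 2 == (2 ^ m)%:R * \sum_(k < m) (z k)%:R ^+ 2) &&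
  (\sum_(i < 2 ^ m) y i * walsh m (fun k => t%:R ^+ k) i
    == (2 ^ m)%:R * \sum_(k < m) (z k)%:R * t%:R ^+ k).

Lemma Fp_nat_inj p x y : prime p -> (x < p)%N -> (y < p)%N ->
  x%:R = y%:R :> 'F_p -> x = y.
Proof.
by move=> pp xp yp /(congr1 val) /=; rewrite !val_Fp_nat // !modn_small.
Qed.

Lemma Fp_nat_eq0 p x : prime p -> ((x%:R : 'F_p) == 0) = (p %| x)%N.
Proof. by move=> pp; rewrite (dvdn_pcharf (pchar_Fp pp)). Qed.

Lemma card_roots_small p T (f : {poly 'F_p}) : prime p -> (T <= p)%N -> f != 0 ->
  (#|[set t : 'I_T | root f t%:R]| < size f)%N.
Proof.
move=> pp Tp f0.
have inj : injective (fun t : 'I_T => t%:R : 'F_p).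
  move=> s t /Fp_nat_inj-/(_ pp) H; apply/val_inj/H; exact: leq_trans (ltn_ord _) Tp.
have := @max_poly_roots _ f [seq (t : 'I_T)%:R | t <- enum [set t : 'I_T | root f t%:R]] f0.
rewrite size_map -cardE; apply; last by rewrite map_inj_uniq ?enum_uniq.
by apply/allP => _ /mapP [t + ->]; rewrite mem_enum inE.
Qed.

(* Modulo a prime not dividing the integer [sum_i (a i - g i)^2], a false claim vector violates one of the [m] correlation identities, which the evaluation at [t] combines into one polynomial. *)
Lemma claim_sound p T m M z a : prime p -> (T <= p)%N -> (forall k, z k <= M)%N ->
  ~~ (p %| sq_dist m a (weight m M z))%N ->
  (#|[set t : 'I_T | claim_ok p m M z a t]| <= m)%N.
Proof.
move=> pp Tp zM nQ.
set y := fun i => (a i)%:R - (m * M)%:R : 'F_p.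
pose zR := fun k => (z k)%:R : 'F_p.
set norm := \sum_(i < 2 ^ m) y i ^+ 2 == (2 ^ m)%:R * \sum_(k < m) zR k ^+ 2.
have [nT|nF] := boolP norm; last first.
  rewrite (_ : [set t | _] = set0) ?cards0 //; apply/setP => t.
  by rewrite !inE /claim_ok -/norm (negbTE nF).
(* The defects of the correlation identities are the coefficients of [f]. Were they all zero,
   [walsh_rigid] would make the squared distance divisible by [p]. *)
pose coef k := \sum_(i < 2 ^ m) y i * (-1) ^+ bit k i - (2 ^ m)%:R * zR k.
pose f := \poly_(k < m) coef k.
have f0 : f != 0.
  apply: contraNneq nQ => f0; rewrite -Fp_nat_eq0 // sq_distE.
  apply/eqP; rewrite -[RHS](@walsh_rigid _ m y zR).
  - by apply: eq_bigr => i _; rewrite weightE // /y /zR; ring.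
  - exact/eqP.
  - move=> k km; apply/eqP; rewrite -subr_eq0 -/(coef k).
    by have := congr1 (fun g : {poly _} => g`_k) f0; rewrite coef_poly km coef0 => ->.
apply: leq_trans (_ : (#|[set t : 'I_T | root f t%:R]| <= _)%N).
  apply/subset_leq_card/subsetP => t; rewrite !inE /claim_ok => /andP [_].
  rewrite -subr_eq0 rootE horner_poly => /eqP H; apply/eqP; rewrite -{}[RHS]H.
  rewrite -/y big_distrr /=.
  under [X in _ = X - _]eq_bigr do rewrite /walsh big_distrr /=.
  rewrite exchange_big -sumrB; apply: eq_bigr => k _.
  rewrite /coef mulrBl big_distrl /=; congr (_ - _); last by rewrite mulrA.
  by apply: eq_bigr => i _; rewrite mulrA.
by rewrite -ltnS; apply: leq_trans (card_roots_small pp Tp f0) _; rewrite ltnW // ltnS size_poly.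
Qed.

Lemma claim_complete p m M z t : prime p -> (forall k, z k <= M)%N ->
  claim_ok p m M z (weight m M z) t.
Proof.
move=> pp zM; rewrite /claim_ok.
have yE i : (weight m M z i)%:R - (m * M)%:R = walsh m (fun k => (z k)%:R : 'F_p) i.
  by rewrite weightE // addrC addKr.
apply/andP; split; apply/eqP.
  by under eq_bigr do rewrite yE expr2; rewrite walsh_parseval; under eq_bigr do rewrite -expr2.
by under eq_bigr do rewrite yE; rewrite walsh_parseval.
Qed.
End Walsh.

(** * A Schwartz-Zippel bound for multilinear forms on the cube *)

Section SchwartzZippel.
Import GRing.Theory.
Local Open Scope ring_scope.

(** Folding the cube one top bit at a time isolates the contribution of one seed, as the induction
    in [schwartz_zippel] requires. *)
Fixpoint multilinear (R : pzSemiRingType) (m : nat) (w : nat -> bool -> R) (D : nat -> R) : R :=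
  if m is m'.+1 then
    multilinear m' w (fun i => w m' false * D i + w m' true * D (2 ^ m' + i)%N)
  else D 0%N.

Lemma multilinearE (R : comPzSemiRingType) m w (D : nat -> R) :
  multilinear m w D = \sum_(i < 2 ^ m) D i * \prod_(k < m) w k (bit k i).
Proof.
elim: m D => [|m IH] D /=; first by rewrite expn0 big_ord1 big_ord0 mulr1.
rewrite IH (sum_pow2S m (fun i => D i * \prod_(k < m.+1) w k (bit k i))) -big_split /=; apply: eq_bigr => i _.
rewrite !big_ord_recr /= bit_small // bit_top //.
have -> : \prod_(k < m) w k (bit k (2 ^ m + i)) = \prod_(k < m) w k (bit k i).
  by apply: eq_bigr => k _; rewrite bit_addX.
ring.
Qed.

(** Fold the top variable. Either the folded table is zero, which a fixed nonzero pair of entries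
    allows for at most one of the [q] values, or it is nonzero and induction applies. The table [D]
    may depend on the outcome, but not on the variables still to be folded. *)
Lemma schwartz_zippel (R : idomainType) (O : finType) (q m : nat)
    (get : nat -> O -> 'I_q) (set : nat -> O -> 'I_q -> O)
    (W : nat -> 'I_q -> bool -> R) (D : O -> nat -> R) :
  (forall k c x, k < m -> get k (set k c x) = x)%N ->
  (forall k c x y, k < m -> set k (set k c x) y = set k c y)%N ->
  (forall k c, k < m -> set k c (get k c) = c)%N ->
  (forall k l c x, k < m -> l < m -> k != l -> get l (set k c x) = get l c)%N ->
  (forall k c x i, k < m -> D (set k c x) i = D c i)%N ->
  (forall k (d0 d1 : R), (d0 != 0) || (d1 != 0) ->
     (#|[set x | (W k x false * d0 + W k x true * d1 == 0)%R]| <= 1)%N) ->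
  (#|[set c | [exists i : 'I_(2 ^ m), D c i != 0%R] &&
        (multilinear m (fun k => W k (get k c)) (D c) == 0%R)]| * q <= m * #|O|)%N.
Proof.
move=> gs ss sg gg + W1; elim: m D gs ss sg gg => [|m IH] D gs ss sg gg Dinv.
  rewrite mul0n (_ : [set c | _] = set0) ?cards0 //; apply/setP => c; rewrite !inE /=.
  apply/negbTE/negP => /andP[/existsP[[[|i] //=]]] _ /negbTE ->.
  by [].
pose D' c i := W m (get m c) false * D c i + W m (get m c) true * D c (2 ^ m + i)%N.
(* The event that the value [x] of the top variable annihilates a nonzero table. *)
pose E c x := [exists i : 'I_(2 ^ m.+1), D c i != 0] &&
  [forall i : 'I_(2 ^ m), W m x false * D c i + W m x true * D c (2 ^ m + i)%N == 0].
have sub : [set c | [exists i : 'I_(2 ^ m.+1), D c i != 0] &&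
        (multilinear m.+1 (fun k => W k (get k c)) (D c) == 0)]
  \subset [set c | E c (get m c)] :|:
    [set c | [exists i : 'I_(2 ^ m), D' c i != 0] &&
        (multilinear m (fun k => W k (get k c)) (D' c) == 0)].
  apply/subsetP => c; rewrite !inE => /andP[h1 h2]; rewrite /E h1 /= h2 andbT.
  by rewrite -negb_forall orbN.
have b1 : (#|[set c | E c (get m c)]| * #|'I_q| <= 1 * #|O|)%N.
  apply: (lens_count (set := set m)).
  - by move=> c x; apply: gs.
  - by move=> c x y; apply: ss.
  - by move=> c; apply: sg.
  - move=> c x y; rewrite /E; congr andb.
      by apply: eq_existsb => i; rewrite Dinv.
    by apply: eq_forallb => i; rewrite !Dinv.
  - move=> c; have [/existsP [i Di]|nD] := boolP [exists i : 'I_(2 ^ m.+1), D c i != 0]; last first.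
      rewrite (_ : [set x | _] = set0) ?cards0 //; apply/setP => x.
      by rewrite !inE /E (negbTE nD).
    have [j Dj] : exists j : 'I_(2 ^ m), (D c j != 0) || (D c (2 ^ m + j)%N != 0).
      have [im|mi] := ltnP i (2 ^ m); first by exists (Ordinal im); rewrite Di.
      have im : (i - 2 ^ m < 2 ^ m)%N.
        have e : (2 ^ m.+1 = 2 ^ m + 2 ^ m)%N by rewrite expnS mul2n addnn.
        by have := ltn_ord i; move: mi e; lia.
      by exists (Ordinal im); rewrite /= subnKC // Di orbT.
    apply: leq_trans (W1 m _ _ Dj); apply/subset_leq_card/subsetP => x.
    by rewrite !inE => /andP[_ /forallP/(_ j)].
have b2 := IH D' _ _ _ _ _.
rewrite mulSn.
apply: (@leq_trans ((#|[set c | E c (get m c)]| + #|[set c | [exists i : 'I_(2 ^ m), D' c i != 0%R] &&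
        (multilinear m (fun k => W k (get k c)) (D' c) == 0%R)]|) * q)).
  rewrite leq_mul2r; apply/orP; right.
  by apply: leq_trans (subset_leq_card sub) _; rewrite cardsU leq_subr.
rewrite mulnDl; apply: leq_add; first by rewrite mul1n card_ord in b1.
apply: b2.
- by move=> k c x km; apply: gs; apply: ltnW.
- by move=> k c x y km; apply: ss; apply: ltnW.
- by move=> k c km; apply: sg; apply: ltnW.
- by move=> k l c x km lm; apply: gg; apply: ltnW.
- move=> k c x i km; rewrite /D' gg ?Dinv // ?ltnS //; try exact: ltnW.
  by rewrite neq_ltn km.
Qed.

(** A root [s] satisfies [x ^ (2 * s) * d0 = - d1]; two distinct roots would force [d0], and then
    [d1], to vanish. The bound on [q] keeps [M - s] from being truncated. *)
Lemma power_pair_root (R : idomainType) (x : R) (q M : nat) (d0 d1 : R) :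
  x != 0 -> (forall i j, x ^+ i = x ^+ j -> i = j) -> (q <= M.+1)%N ->
  (d0 != 0) || (d1 != 0) ->
  (#|[set s : 'I_q | (x ^+ (M + s) * d0 + x ^+ (M - s) * d1 == 0)%R]| <= 1)%N.
Proof.
move=> x0 xinj qM d01; apply: contraLR d01; rewrite -ltnNge negb_or !negbK.
move/card_gt1P => [s [s' [+ + ss']]].
have key u : u \in [set s : 'I_q | (x ^+ (M + s) * d0 + x ^+ (M - s) * d1 == 0)%R] ->
    x ^+ (u + u) * d0 = - d1.
  have uM : (u <= M)%N by rewrite -ltnS; apply: leq_trans (ltn_ord u) qM.
  rewrite inE; have -> : (M + u = (M - u) + (u + u))%N by lia.
  rewrite exprD -mulrA -mulrDr mulf_eq0 expf_eq0 (negbTE x0) andbF /= addr_eq0.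
  by move/eqP.
move=> /key k1 /key k2.
have : d0 * (x ^+ (s + s) - x ^+ (s' + s')) = 0.
  by rewrite mulrBr mulrC k1 mulrC k2 subrr.
move/eqP; rewrite mulf_eq0 => /orP [d0E|].
  rewrite d0E /=; move: k1; rewrite (eqP d0E) mulr0 => /eqP.
  by rewrite eq_sym oppr_eq0.
rewrite subr_eq0 => /eqP /xinj e; case/eqP: ss'; apply: val_inj => /=; lia.
Qed.
End SchwartzZippel.

(** * Colourings avoiding multiples of a prime *)

Lemma fact_pow2_le k C : 2 * k <= C -> k`! * 2 ^ k <= C ^ k.
Proof.
elim: k C => // k IH C kC; rewrite factS !expnS.
have := IH C ltac:(lia); nia.
Qed.

(** All members of [F] are rearrangements of any one of them. *)
Lemma card_same_counts (k C : nat) (F : {set {ffun 'I_k -> 'I_C}}) :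
  (forall a a' c, a \in F -> a' \in F -> #|[set i | a i == c]| = #|[set i | a' i == c]|) ->
  #|F| <= k`!.
Proof.
move=> FF; have [->|[a0 a0F]] := set_0Vmem F; first by rewrite cards0.
rewrite -card_Sn -cardsT.
apply: leq_trans (leq_imset_card (fun s : 'S_k => [ffun i => a0 (s i)]) [set: 'S_k]).
apply/subset_leq_card/subsetP => a aF.
have : perm_eq [tuple a i | i < k] [tuple a0 i | i < k].
  apply/allP => c _ /=.
  have cE (b : {ffun 'I_k -> 'I_C}) : count_mem c [seq b i | i <- enum 'I_k] = #|[set i | b i == c]|.
    by rewrite count_map -sum1_card -sum1_count big_enum_cond /=; apply: eq_bigl => i; rewrite inE.
  by rewrite !cE (FF a a0).
case/tuple_permP => s sE; apply/imsetP; exists s => //; apply/ffunP => i; rewrite ffunE.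
have := congr1 (fun t => nth (a i) t i) sE.
rewrite (nth_map i) ?size_enum_ord // nth_ord_enum => ->.
by rewrite (nth_map i) ?size_enum_ord // nth_ord_enum tnth_mktuple.
Qed.

Lemma card_bigcup_le (I T : finType) (P : pred I) (A : I -> {set T}) :
  #|\bigcup_(i | P i) A i| <= \sum_(i | P i) #|A i|.
Proof.
elim/big_rec2: _ => [|i s B _ IH]; first by rewrite cards0.
by apply: leq_trans (leq_card_setU _ _) _; rewrite leq_add2l.
Qed.

Section Colouring.
Variables (T : finType) (p k C : nat).
Hypotheses (kp : k < p) (kC : 2 * k <= C).

Definition bad_colourings (S : {set T}) : {set {ffun T -> 'I_C}} :=
  [set x : {ffun T -> 'I_C} | [forall c, p %| #|[set u in S | x u == c]|]].

(* Once all colours outside [k < p] points of [S] are fixed, divisibility by [p] determines how often each colour is used on these points. *)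
Lemma card_bad_colourings (S : {set T}) : S != set0 ->
  #|bad_colourings S| * 2 ^ k <= #|{ffun T -> 'I_C}|.
Proof.
(* With fewer than [p] points in [S], the colour class of any of them has a size strictly between 0
   and [p]. *)
move=> S0; have [Sp|pS] := ltnP #|S| p.
  rewrite (_ : bad_colourings S = set0) ?cards0 //; apply/setP => x; rewrite !inE.
  apply/negbTE/negP => /forallP H; case/set0Pn: S0 => u uS.
  have c0 : 0 < #|[set w in S | x w == x u]|.
    by apply/card_gt0P; exists u; rewrite inE uS /=.
  have := dvdn_leq c0 (H (x u)); rewrite leqNgt => /negP; apply.
  apply: leq_ltn_trans Sp; apply/subset_leq_card/subsetP => w.
  by rewrite inE => /andP[].
case/set0Pn: S0 => u0 _.
(* [b] lists the points of [S] whose colours the lens below reads and resamples. *)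
pose b (i : 'I_k) := nth u0 (enum S) i.
have ltS (i : 'I_k) : i < size (enum S).
  by rewrite -cardE (leq_trans (ltn_ord i)) // ltnW // (leq_trans kp).
have b_inj : injective b.
  move=> i j /eqP; rewrite /b nth_uniq ?enum_uniq //; by move/eqP/val_inj.
have bS i : b i \in S by rewrite -mem_enum mem_nth.
pose get (x : {ffun T -> 'I_C}) := [ffun i => x (b i)].
pose set (x : {ffun T -> 'I_C}) (a : {ffun 'I_k -> 'I_C}) :=
  [ffun u => if [pick i | b i == u] is Some i then a i else x u].
have setb x a i : set x a (b i) = a i.
  rewrite ffunE; case: pickP => [j /eqP /b_inj -> //|/(_ i)]; by rewrite eqxx.
have setNb x a u : (forall i, b i != u) -> set x a u = x u.
  by move=> H; rewrite ffunE; case: pickP => // j; rewrite (negbTE (H j)).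
have bP u : (exists i, b i = u) \/ (forall i, b i != u).
  case: (pickP (fun i => b i == u)) => [i /eqP|H]; first by left; exists i.
  by right => i; rewrite H.
have : #|[set x | set x (get x) \in bad_colourings S]| * #|{ffun 'I_k -> 'I_C}|
    <= k`! * #|{ffun T -> 'I_C}|.
  apply: (@lens_count _ _ get set (fun x a => set x a \in bad_colourings S)).
  - by move=> x a; apply/ffunP => i; rewrite ffunE setb.
  - move=> x a a'; apply/ffunP => u; have [[i <-]|H] := bP u; first by rewrite !setb.
    by rewrite !setNb.
  - move=> x; apply/ffunP => u; have [[i <-]|H] := bP u; first by rewrite setb ffunE.
    by rewrite setNb.
  - move=> x a a'; suff -> : set (set x a) a' = set x a' by []; apply/ffunP => u.
    by have [[i <-]|H] := bP u; [rewrite !setb | rewrite !setNb].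
  - move=> x; apply: card_same_counts => a a' c.
    have cE y : #|[set u in S | set x y u == c]|
       = #|[set i | y i == c]| + #|[set u in S | [forall i, b i != u] && (x u == c)]|.
      rewrite -(card_imset _ b_inj) -cardsUI.
      rewrite [X in _ + X](_ : _ = 0) ?addn0; last first.
        apply: eq_card0 => u; rewrite !inE; apply/negbTE/negP.
        case/andP => /imsetP [i _ ->] /and3P [_ /forallP /(_ i)]; by rewrite eqxx.
      apply: eq_card => u; rewrite !inE; have [[i <-]|H] := bP u.
        rewrite setb bS /= (mem_imset _ _ b_inj) inE.
        case: forallP => [/(_ i)|_]; by rewrite ?eqxx // orbF.
      rewrite setNb // (introT forallP H) /=.
      case: imsetP => // -[i _ e]; by have := H i; rewrite e eqxx.
    rewrite !inE => /forallP/(_ c) + /forallP/(_ c); rewrite !cE.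
    set z := #|[set u in S | _]| => d1 d2.
    have le y : #|[set i : 'I_k | y i == c :> 'I_C]| < p.
      by apply: leq_ltn_trans (max_card _) _; rewrite card_ord.
    have : #|[set i | a i == c]| + z = #|[set i | a' i == c]| + z %[mod p].
      by rewrite (eqP d1) (eqP d2).
    by move/eqP; rewrite eqn_modDr !modn_small // => /eqP.
rewrite [X in _ * X <= _]card_ffun !card_ord.
rewrite (_ : [set x | _] = bad_colourings S); last first.
  apply/setP => x; rewrite [LHS]inE; suff -> : set x (get x) = x by []; apply/ffunP => u.
  by have [[i <-]|H] := bP u; [rewrite setb ffunE | rewrite setNb].
move=> H; have F := fact_pow2_le kC.
have f0 := fact_gt0 k.
rewrite -(leq_pmul2l f0).
apply: leq_trans H; rewrite mulnCA leq_mul2l F orbT //.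
Qed.

(** Union bound: each nonempty [S v] spoils at most a fraction [2 ^ -k] of the colourings, and there
    are fewer than [2 ^ k] vertices. *)
Lemma good_colouring (S : T -> {set T}) : #|T| < 2 ^ k -> 0 < C ->
  exists x : {ffun T -> 'I_C},
    forall v, S v != set0 -> exists c, ~~ (p %| #|[set u in S v | x u == c]|).
Proof.
move=> Tk C0.
have [x xU|H] := pickP [pred x | x \notin \bigcup_(v | S v != set0) bad_colourings (S v)].
  exists x => v Sv; apply/existsP; rewrite -negb_forall.
  apply: contra xU => H; apply/bigcupP; exists v => //; by rewrite inE.
have : #|{ffun T -> 'I_C}| * 2 ^ k <= #|T| * #|{ffun T -> 'I_C}|.
  have cov : #|{ffun T -> 'I_C}| = #|\bigcup_(v | S v != set0) bad_colourings (S v)|.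
    by apply: eq_card => x; have := H x; rewrite inE /= => /negbFE ->.
  rewrite {1}cov; apply: leq_trans (_ : (\sum_(v | S v != set0) #|bad_colourings (S v)|) * 2 ^ k <= _).
    by rewrite leq_mul2r card_bigcup_le orbT.
  rewrite big_distrl /= -sum_nat_const [X in _ <= X](bigID (fun v => S v != set0)) /=.
  apply: leq_trans (leq_addr _ _); apply: leq_sum => v; exact: card_bad_colourings.
by rewrite mulnC leq_mul2r [2 ^ k <= _]leqNgt Tk orbF card_ffun card_ord expn_eq0; case: (C) C0.
Qed.
End Colouring.

(** * Flows *)

(** [d v] is the least radius of a ball around [r] that contains [v]. *)
Lemma bfs_layering (T : finType) (e : rel T) (r : T) :
  (forall v, connect e r v) ->
  exists d : T -> nat, [/\ d r = 0, forall u v, e u v -> d v <= (d u).+1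
    & forall v, v != r -> exists2 u, e u v & d v = (d u).+1].
Proof.
move=> conn.
pose ball k := iter k (fun A : {set T} => A :|: [set v | [exists u in A, e u v]]) [set r].
have ballS k u v : u \in ball k -> e u v -> v \in ball k.+1.
  move=> uk uv; rewrite /= inE; apply/orP; right; rewrite inE.
  by apply/existsP; exists u; rewrite uk.
have ex v : exists k, v \in ball k.
  have /connectP [q + ->] := conn v; elim/last_ind: q => [|q w IH].
    by exists 0; rewrite /= set11.
  rewrite rcons_path last_rcons => /andP [/IH [k kb] ew]; exists k.+1; exact: ballS kb ew.
pose d v := ex_minn (ex v).
have dP v : v \in ball (d v) by rewrite /d; case: ex_minnP.
have dmin v k : v \in ball k -> d v <= k by rewrite /d; case: ex_minnP => m _; apply.
exists d; split.
- by apply/eqP; rewrite -leqn0; apply: dmin; rewrite /= set11.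
- by move=> u v uv; apply: dmin; apply: ballS uv.
- move=> v vr; have := dP v; case dE: (d v) => [|k].
    by rewrite /= inE (negbTE vr).
  rewrite /= inE => /orP [/dmin|]; first by rewrite dE ltnn.
  rewrite inE => /existsP [u /andP [uk uv]]; exists u => //; congr _.+1.
  apply/eqP; rewrite eqn_leq dmin // andbT.
  have : v \in ball (d u).+1 by apply: ballS uv.
  by move/dmin; rewrite dE ltnS.
Qed.

Section Flow.
Import GRing.Theory.
Local Open Scope ring_scope.

(** [x] is the label at which a vertex receives and [s] the label it sends to. Every neighbour with
    a matching label receives the full amount [phi u]. *)
Definition inflow (T : finType) (V : nmodType) (e : rel T) (x s : T -> nat) (phi : T -> V) (v : T) : V :=
  \sum_(u | e v u) (if x v == s u then phi u else 0).

Definition outflow (T : finType) (V : nmodType) (e : rel T) (x s : T -> nat) (phi : T -> V) (v : T) : V :=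
  \sum_(u | e v u) (if x u == s v then phi v else 0).

Lemma eq_inflow (T : finType) (V : nmodType) (e : rel T) x x' s s' (phi phi' : T -> V) v :
  x =1 x' -> s =1 s' -> phi =1 phi' -> inflow e x s phi v = inflow e x' s' phi' v.
Proof. by move=> ex es ep; apply: eq_bigr => u _; rewrite ex es ep. Qed.

Lemma eq_outflow (T : finType) (V : nmodType) (e : rel T) x x' s s' (phi phi' : T -> V) v :
  x =1 x' -> s =1 s' -> phi =1 phi' -> outflow e x s phi v = outflow e x' s' phi' v.
Proof. by move=> ex es ep; apply: eq_bigr => u _; rewrite ex es ep. Qed.

Lemma sum_inflow (T : finType) (V : nmodType) (e : rel T) x s (phi : T -> V) :
  symmetric e -> \sum_v inflow e x s phi v = \sum_v outflow e x s phi v.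
Proof.
move=> es; rewrite /inflow /outflow.
under eq_bigr do rewrite big_mkcond; rewrite exchange_big /=.
by apply: eq_bigr => v _; rewrite [RHS]big_mkcond; apply: eq_bigr => u _; rewrite es.
Qed.

(** Each amount crossing an edge is counted once as inflow and once as outflow, whatever labels a
    prover chooses. *)
Lemma flow_sound (T : finType) (V : zmodType) (e : rel T) x s (phi f : T -> V) :
  symmetric e -> (forall v, f v + inflow e x s phi v = outflow e x s phi v) ->
  \sum_v f v = 0.
Proof.
move=> es H; have : \sum_v (f v + inflow e x s phi v) = \sum_v outflow e x s phi v.
  by apply: eq_bigr => v _; rewrite H.
rewrite big_split /= sum_inflow // => Hs.
by apply: (addIr (\sum_v outflow e x s phi v)); rewrite add0r.
Qed.

(* A vertex splits its flow evenly among the neighbours in the previous layer that carry one chosen colour; single parents cannot be designated, because short labels cannot distinguish all neighbours. *)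
Lemma flow_complete (T : finType) (e : rel T) (p k : nat) :
  symmetric e -> (forall u v, connect e u v) -> prime p -> (k < p)%N -> (#|T| < 2 ^ k)%N -> (0 < k)%N ->
  exists x s : T -> nat,
    [/\ forall v, (x v < 6 * k)%N, forall v, (s v <= 6 * k)%N &
     forall f : T -> 'F_p, \sum_v f v = 0 ->
       exists phi : T -> 'F_p, forall v, f v + inflow e x s phi v = outflow e x s phi v].
Proof.
move=> es conn pp kp Tk k0.
have [T0|[r _]] := set_0Vmem [set: T].
  have nT (v : T) : False by have := in_setT v; rewrite T0 inE.
  exists (fun _ => 0%N), (fun _ => 0%N); split=> // f _.
  by exists f => v; case: (nT v).
have [d [d_r d_le d_pred]] := bfs_layering (conn r).
pose S v := [set u | e v u && (d v == (d u).+1)].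
have SP v : v != r -> S v != set0.
  move=> /d_pred [u uv du]; apply/set0Pn; exists u; rewrite inE es uv du eqxx //.
have [col colP] := @good_colouring T p k (2 * k) kp (leqnn _) S Tk ltac:(lia).
have [c cP] : exists c : T -> 'I_(2 * k), forall v, v != r ->
    ~~ (p %| #|[set u in S v | col u == c v]|)%N.
  apply: (fin_all_exists (P := fun v c => v != r -> ~~ (p %| #|[set u in S v | col u == c]|)%N)) => v.
  have [->|vr] := eqVneq v r; first by exists (col r).
  by have [c cP] := colP v (SP v vr); exists c.
(* Layers of neighbours differ by at most one, so the layer modulo 3 tells previous, same and next
   apart. *)
pose x v := (3 * col v + d v %% 3)%N.
(* The root sends to the label [6 * k], which no vertex carries; the others aim at the previous
   layer, [d v - 1] modulo 3. *)
pose s v := if v == r then (6 * k)%N else (3 * c v + (d v + 2) %% 3)%N.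
have x_lt v : (x v < 6 * k)%N.
  by have := ltn_ord (col v); have := @ltn_pmod (d v) 3 isT; rewrite /x; lia.
have match_ v u : e v u -> x v == s u -> [/\ u != r, d u = (d v).+1 & col v = c u].
  move=> vu; rewrite /s; have [_ /eqP e1|ur /eqP e1] := eqVneq u r.
    by have := x_lt v; rewrite e1 ltnn.
  have := d_le _ _ vu; have := d_le u v; rewrite es => /(_ vu) h1 h2.
  split=> //; last apply: val_inj; move: e1; rewrite /x /=; lia.
exists x, s; split=> // [v|f f0].
  rewrite /s; case: eqP => // _; have := ltn_ord (c v); lia.
pose K v : 'F_p := #|[set u in S v | col u == c v]|%:R.
have K0 v : v != r -> K v != 0 by move=> /cP; rewrite /K Fp_nat_eq0.
have outE phi v : v != r -> outflow e x s phi v = phi v * K v.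
  move=> vr; rewrite /outflow -big_mkcondr /= sumr_const /K mulr_natr; congr (_ *+ _).
  apply: eq_card => u; rewrite !inE; apply/andP/andP.
    move=> [vu]; have uv : e u v by rewrite es.
    by move=> /(match_ _ _ uv) [_ -> ->]; rewrite vu !eqxx.
  case=> /andP [vu /eqP du] /eqP cu; split=> //; rewrite /x /s (negbTE vr) cu du.
  by apply/eqP; congr addn; lia.
have [phi phiP] : exists phi : T -> 'F_p, forall v, v != r ->
    f v + inflow e x s phi v = outflow e x s phi v.
  pose N := \max_v d v.
  suff H j : exists phi : T -> 'F_p, forall v, v != r -> (N < d v + j)%N ->
      f v + inflow e x s phi v = outflow e x s phi v.
    have [phi phiP] := H N.+1; exists phi => v vr; apply: phiP => //; lia.
  elim: j => [|j [phi phiP]].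
    exists (fun _ => 0) => v _; rewrite addn0 ltnNge; case/negP.
    exact: (leq_bigmax (F := d)).
  (* Layers are treated from the deepest upwards. Inflow comes only from the next deeper layer,
     already settled, and [K v], the number of receivers, is invertible modulo [p]. *)
  pose phi' v := if (d v + j == N)%N then (f v + inflow e x s phi v) / K v else phi v.
  have inE' v : (N <= d v + j)%N -> inflow e x s phi' v = inflow e x s phi v.
    move=> Nv; apply: eq_bigr => u vu; case: ifP => // /(match_ _ _ vu) [_ du _].
    by rewrite /phi' ifF //; apply/eqP; lia.
  exists phi' => v vr; rewrite addnS ltnS => Nv; rewrite inE' // outE // /phi'.
  case: eqP => [_|/eqP dN]; first by rewrite divfK ?K0.
  by rewrite -outE // phiP //; lia.
(* The equation at the root follows from the others by summing over all vertices, since [f] has sum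
   zero. *)
exists phi => v; have [->|vr] := eqVneq v r; last exact: phiP.
have : \sum_v (f v + inflow e x s phi v) = \sum_v outflow e x s phi v.
  by rewrite big_split /= f0 add0r sum_inflow.
rewrite (bigD1 r) //= [RHS](bigD1 r) //= (eq_bigr _ phiP).
exact: addIr.
Qed.
End Flow.

(** * The protocol *)

(* [cube_dim n + 2 <= 2 ^ loglog n]; the other widths make the four error terms [2 m / 2 ^ seed_width], [(m + 2 field_width) / 2 ^ index_width], [m / 2 ^ point_width] and [radix ^ 2 / 2 ^ point_width] small, with primes taken between [2 ^ point_width] and [2 ^ field_width]. *)
Definition loglog (n : nat) : nat := trunc_log 2 (trunc_log 2 n) + 3.
Definition seed_width (n : nat) : nat := loglog n + 5.
Definition radix_width (n : nat) : nat := 2 * loglog n + 7.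
Definition point_width (n : nat) : nat := 4 * loglog n + 20.
Definition field_width (n : nat) : nat := 2 * point_width n.
Definition index_width (n : nat) : nat := loglog n + 13.

Definition cube_dim (n : nat) : nat := up_log 2 n.
Definition seed_range (n : nat) : nat := 2 ^ seed_width n.
Definition radix (n : nat) : nat := 2 ^ radix_width n.
Definition seed_cap (n : nat) : nat := seed_range n + radix n * seed_range n.

Definition seed1 (n : nat) (c : bitseq) : nat := slice 0 (seed_width n) c.
Definition seed2 (n : nat) (c : bitseq) : nat := slice (seed_width n) (seed_width n) c.
Definition seed (n : nat) (c : bitseq) : nat := seed1 n c + radix n * seed2 n c.

Definition prime_index (n : nat) (c : bitseq) : nat := slice 0 (index_width n) c.
Definition corr_point (n : nat) (c : bitseq) : nat := slice (index_width n) (point_width n) c.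
Definition finger_point (n : nat) (c : bitseq) : nat :=
  slice (index_width n + point_width n) (point_width n) c.

(** The default 2 is never reached for an index below [2 ^ index_width n]. *)
Definition challenge_prime (n j : nat) : nat :=
  nth 2 (primes_in (2 ^ point_width n) (2 ^ field_width n)) j.

(** [pid] is defined exactly on the identifiers in use, so every node can compute these
    positions. *)
Definition rank (pid : nat -> option nat) (x : nat) : nat :=
  count (fun y => isSome (pid y)) (iota 0 x).

(** Joins the low digit of [a] to the high digit of [b]: on codes this is [g1 + radix * g2] for an
    ordered pair of vertices. *)
Definition pair_exponent (n a b : nat) : nat := a %% radix n + radix n * (b %/ radix n).

Section Residual.
Import GRing.Theory.
Local Open Scope ring_scope.

Definition norm_term (n p a : nat) : 'F_p := (a%:R - (cube_dim n * seed_cap n)%:R) ^+ 2.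

Definition corr_term (n p t i a : nat) : 'F_p :=
  (a%:R - (cube_dim n * seed_cap n)%:R) * walsh (cube_dim n) (fun k => t%:R ^+ k) i.

(* A node of rank [r] also answers for the index [n + r] when that index lies in the cube, so that all of [0, 2 ^ cube_dim n) is covered even if [n] is not a power of two. *)
Definition residual (n p t w r rp a ad ap z : nat) (nbrs : seq (nat * nat)) (q : nat) : 'F_p :=
  let extra (x : 'F_p) := if (n + r < 2 ^ cube_dim n)%N then x else 0 in
  let N : 'F_p := (2 ^ cube_dim n)%:R in
  nth 0 [:: norm_term n p a + extra (norm_term n p ad) - N * z%:R ^+ 2;
    corr_term n p t r a + extra (corr_term n p t (n + r)%N ad) - N * (z%:R * t%:R ^+ r);
    norm_term n p ap + extra (norm_term n p ad) - N * z%:R ^+ 2;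
    corr_term n p t rp ap + extra (corr_term n p t (n + r)%N ad) - N * (z%:R * t%:R ^+ r);
    \sum_(b <- nbrs) (w%:R ^+ pair_exponent n ap b.2 - w%:R ^+ pair_exponent n a b.1)] q.

(* The second prover message packs the claimed codes of the node, of its extra index and of its image under the permutation; the third packs the prime index, the two points, the node's flow label, the label its own flow is sent to, and one flow value for each of the five sums. *)
Definition dsym_decide (n id : nat) (pid : nat -> option nat) (nids : seq nat)
    (c1 c2 : bitseq) (s : bitseq * bitseq * bitseq)
    (ss : seq (bitseq * bitseq * bitseq)) : bool :=
  let fld := field_at (field_width n) in
  let r := rank pid id in
  let rp := rank pid (odflt 0%N (pid id)) in
  let j := fld s.2 0%N in let t := fld s.2 1%N in let w := fld s.2 2%N in
  let p := challenge_prime n j in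
  [&& all (fun s' => [&& fld s'.2 0%N == j, fld s'.2 1%N == t & fld s'.2 2%N == w]) ss,
    (r == 0%N) ==> [&& j == prime_index n c2, t == corr_point n c2 & w == finger_point n c2]
  & all (fun q =>
      residual n p t w r rp (fld s.1.2 0%N) (fld s.1.2 1%N) (fld s.1.2 2%N)
        (if (r < cube_dim n)%N then seed n c1 else 0%N)
        [seq (fld s'.1.2 0%N, fld s'.1.2 2%N) | s' <- ss] q
      + \sum_(s' <- ss) (if fld s.2 3%N == fld s'.2 4%N then (fld s'.2 (5 + q)%N)%:R else 0)
      == \sum_(s' <- ss) (if fld s'.2 3%N == fld s.2 4%N then (fld s.2 (5 + q)%N)%:R else 0))
    (iota 0 5)].
End Residual.

(** Ten fields hold the longest message: three challenges, two flow labels and five flow values. *)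
Definition dsym_protocol : protocol :=
  Protocol (fun n => 10 * field_width n) dsym_decide.

(** * Numerical bounds on the parameters *)

Section Widths.
Variable n : nat.

Lemma cube_dim_ge : n <= 2 ^ cube_dim n. Proof. exact: up_logP. Qed.

Lemma cube_dim_le : 0 < n -> 2 ^ cube_dim n <= n + n.
Proof.
move=> n0; rewrite /cube_dim; have [n1|n1] := ltnP 1 n; last first.
  by have -> : n = 1 by lia.
have := up_log_gtn (isT : 1 < 2) n1; have := cube_dim_ge; rewrite /cube_dim.
case: (up_log 2 n) => [|k] /=; first lia.
rewrite expnS; lia.
Qed.

Lemma cube_dim_leq : cube_dim n <= n.
Proof. by apply: up_log_min => //; apply/ltnW/ltn_expl. Qed.

Lemma cube_dim_loglog : cube_dim n + 2 <= 2 ^ loglog n.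
Proof.
have h1 : cube_dim n <= (trunc_log 2 n).+1.
  by apply: up_log_min => //; apply/ltnW/trunc_log_ltn.
have h2 := trunc_log_ltn (trunc_log 2 n) (isT : 1 < 2).
rewrite /loglog; move: h1 h2; rewrite addn3 !expnS.
by have := expn_gt0 2 (trunc_log 2 (trunc_log 2 n)); lia.
Qed.

(** This keeps the codes built from either half of the seeds below the radix, so that the
    base-[radix n] digits never carry. *)
Lemma seed_range_radix : cube_dim n * (2 * seed_range n) < radix n.
Proof.
have := cube_dim_loglog; rewrite /seed_range /radix /seed_width /radix_width.
have -> : 2 * loglog n + 7 = loglog n + (loglog n + 7) by lia.
rewrite !expnD; set a := 2 ^ loglog n.
have a0 : 0 < a by rewrite expn_gt0.
have -> : 2 ^ 5 = 32 by []. have -> : 2 ^ 7 = 128 by [].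
nia.
Qed.

Lemma radix_gt0 : 0 < radix n. Proof. by rewrite expn_gt0. Qed.

Lemma challenge_primeP j : j < 2 ^ index_width n ->
  [/\ prime (challenge_prime n j), 2 ^ point_width n <= challenge_prime n j
    & challenge_prime n j < 2 ^ field_width n].
Proof.
move=> jl; apply/and3P.
have le : 2 ^ point_width n <= 2 ^ field_width n by rewrite leq_exp2l // /field_width; lia.
rewrite -(mem_primes_in _ le); apply: mem_nth; apply: leq_trans jl _.
apply: leq_trans (size_primes_in _); last by rewrite /point_width; lia.
by rewrite leq_exp2l // /index_width /point_width; lia.
Qed.

Lemma challenge_prime_inj i j : i < 2 ^ index_width n -> j < 2 ^ index_width n ->
  challenge_prime n i = challenge_prime n j -> i = j.
Proof.
have le : 2 ^ index_width n <= size (primes_in (2 ^ point_width n) (2 ^ field_width n)).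
  apply: leq_trans (size_primes_in _); last by rewrite /point_width; lia.
  by rewrite leq_exp2l // /index_width /point_width; lia.
move=> il jl /eqP; rewrite /challenge_prime nth_uniq ?uniq_primes_in //.
- by move/eqP.
- exact: leq_trans il le.
- exact: leq_trans jl le.
Qed.

(** [seed_cap] is itself [seed_range] in both digits, so the subtraction splits digitwise without
    truncation. *)
Lemma weight_split z1 z2 i :
  (forall k, z1 k < seed_range n) -> (forall k, z2 k < seed_range n) ->
  weight (cube_dim n) (seed_cap n) (fun k => z1 k + radix n * z2 k) i
  = weight (cube_dim n) (seed_range n) z1 i
    + radix n * weight (cube_dim n) (seed_range n) z2 i.
Proof.
move=> h1 h2; rewrite /weight big_distrr -big_split /=; apply: eq_bigr => k _.
have := h1 k; have := h2 k; rewrite /seed_cap; case: ifP => _ *; nia.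
Qed.

Lemma weight_lt_radix z i : (forall k, z k < seed_range n) ->
  weight (cube_dim n) (seed_range n) z i < radix n.
Proof.
move=> h; apply: leq_ltn_trans seed_range_radix.
rewrite /weight -[X in X * _]card_ord -sum_nat_const; apply: leq_sum => k _.
by have := h k; case: ifP; lia.
Qed.

Lemma weight_lt_field z1 z2 i :
  (forall k, z1 k < seed_range n) -> (forall k, z2 k < seed_range n) ->
  weight (cube_dim n) (seed_cap n) (fun k => z1 k + radix n * z2 k) i < 2 ^ field_width n.
Proof.
move=> h1 h2; rewrite weight_split //.
have := weight_lt_radix i h1; have := weight_lt_radix i h2.
set x := weight _ _ _ _; set y := weight _ _ _ _ => xr yr.
apply: leq_trans (_ : radix n * radix n <= _); first nia.
by rewrite /radix -expnD leq_exp2l // /field_width /point_width /radix_width; lia.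
Qed.
End Widths.

(** * Ranks and global sums *)

Section Instance.
Variables (cst n : nat) (I : instance n).
Hypothesis valid : valid_instance cst I.

Let n0 : 0 < n. Proof. by case: valid. Qed.
Let adj_sym : symmetric (adj I). Proof. by case: valid => _ []. Qed.
Let adj_conn u v : connect (adj I) u v. Proof. by case: valid => _ [_ [_ [H _]]]. Qed.
Let ids_inj : injective (ids I). Proof. by case: valid => _ [_ [_ [_ [H _]]]]. Qed.
Let ports_adj v : perm_eq (ports I v) [seq u <- enum 'I_n | adj I v u].
Proof. by case: valid => _ [_ [_ [_ [_ [_ H]]]]]. Qed.

Notation m := (cube_dim n).
Notation perm := (Defs.perm_in I).

Lemma pi_on_ids_id v : pi_on_ids I (ids I v) = Some (ids I (perm v)).
Proof.
rewrite /pi_on_ids; case: pickP => [u /eqP /ids_inj -> //|/(_ v)].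
by rewrite eqxx.
Qed.

Lemma pi_on_idsP x : reflect (exists v, ids I v = x) (isSome (pi_on_ids I x)).
Proof.
apply: (iffP idP) => [|[v <-]]; last by rewrite pi_on_ids_id.
by rewrite /pi_on_ids; case: pickP => // v /eqP <- _; exists v.
Qed.

Definition vrank (v : 'I_n) : nat := rank (pi_on_ids I) (ids I v).

Lemma vrank_lt v : vrank v < n.
Proof.
rewrite /vrank /rank -size_filter.
apply: (@leq_ltn_trans (size [seq ids I u | u <- enum [set~ v]])); last first.
  by rewrite size_map -cardE cardsC1 card_ord prednK.
apply: uniq_leq_size => [|x]; first exact/filter_uniq/iota_uniq.
rewrite mem_filter mem_iota => /andP [/pi_on_idsP [u <-]] /= ux.
by apply: map_f; rewrite mem_enum !inE; apply: contraTneq ux => ->; rewrite ltnn.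
Qed.

Lemma vrank_inj : injective vrank.
Proof.
have mono u v : ids I u < ids I v -> vrank u < vrank v.
  move=> uv; have e : ids I v = ids I u + (ids I v - ids I u).-1.+1 by lia.
  rewrite /vrank /rank e iotaD count_cat /= (introT (pi_on_idsP _)); last by exists u.
  by rewrite add1n addnS ltnS leq_addr.
move=> u v e; apply: ids_inj; case: (ltngtP (ids I u) (ids I v)) => // /mono; rewrite e ltnn //.
Qed.

Definition vertex_of (k : nat) : 'I_n :=
  odflt (Ordinal n0) [pick v | vrank v == k].

Lemma vrankK v : vertex_of (vrank v) = v.
Proof.
rewrite /vertex_of; case: pickP => [u /eqP /vrank_inj //|/(_ v)]; by rewrite eqxx.
Qed.

Lemma vertex_ofK k : k < n -> vrank (vertex_of k) = k.
Proof.
move=> kn; pose f v := Ordinal (vrank_lt v).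
have f_inj : injective f by move=> u v /(congr1 val) /= /vrank_inj.
have [g _ gK] := injF_bij f_inj.
have e : vrank (g (Ordinal kn)) = k by have := congr1 val (gK (Ordinal kn)).
by rewrite -{1}e vrankK.
Qed.

Lemma vertex_of_inj k l : k < n -> l < n -> vertex_of k = vertex_of l -> k = l.
Proof. by move=> kn ln e; rewrite -(vertex_ofK kn) e vertex_ofK. Qed.

Section Sums.
Import GRing.Theory.
Local Open Scope ring_scope.

Lemma sum_vrank (V : nmodType) (F : 'I_n -> V) : \sum_v F v = \sum_(k < n) F (vertex_of k).
Proof.
apply: (reindex (fun k : 'I_n => vertex_of k)); apply: onW_bij; apply: injF_bij.
by move=> k l /vertex_of_inj-/(_ (ltn_ord _) (ltn_ord _)) /val_inj.
Qed.

Lemma sum_ports (V : nmodType) v (F : 'I_n -> V) :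
  \sum_(u <- ports I v) F u = \sum_(u | adj I v u) F u.
Proof. by rewrite (perm_big _ (ports_adj v)) /= big_filter big_enum_cond. Qed.

(** The claim vector on the whole cube. As [2 ^ cube_dim n <= n + n], the index [i - n] is again a
    rank. *)
Definition spread (f fd : 'I_n -> nat) (i : nat) : nat :=
  if (i < n)%N then f (vertex_of i) else fd (vertex_of (i - n)).

Lemma sum_spread (V : nmodType) (G : nat -> nat -> V) f fd :
  \sum_v (G (vrank v) (f v)
     + (if (n + vrank v < 2 ^ m)%N then G (n + vrank v)%N (fd v) else 0))
  = \sum_(i < 2 ^ m) G i (spread f fd i).
Proof.
have := cube_dim_ge n; have := cube_dim_le n0; set N := (2 ^ m)%N => N1 N2.
rewrite big_split /= -(big_mkord xpredT (fun i => G i (spread f fd i))).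
rewrite (@big_cat_nat _ _ _ n) //=; congr (_ + _).
  rewrite sum_vrank big_mkord; apply: eq_bigr => k _.
  by rewrite vertex_ofK // /spread ltn_ord.
rewrite sum_vrank.
have -> : \sum_(n <= i < N) G i (spread f fd i)
    = \sum_(i < N - n) G (i + n)%N (spread f fd (i + n)%N).
  by rewrite -{1}[n]add0n big_addn big_mkord.
rewrite (big_ord_widen_cond n xpredT (fun i => G (i + n)%N (spread f fd (i + n)%N))); last lia.
rewrite [RHS]big_mkcond; apply: eq_bigr => k _; rewrite vertex_ofK //= ltn_subRL.
by rewrite /spread [(_ + n < n)%N]ltnNge leq_addl addnK /= addnC.
Qed.

Definition seeds (c1 : 'I_n -> bitseq) (g : nat -> bitseq -> nat) (k : nat) : nat :=
  if (k < m)%N then g n (c1 (vertex_of k)) else 0%N.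

Lemma sum_seeds (V : nmodType) (F : nat -> V) : (forall k, (m <= k)%N -> F k = 0) ->
  \sum_v F (vrank v) = \sum_(k < m) F k.
Proof.
move=> F0; rewrite sum_vrank (big_ord_widen n _ (cube_dim_leq n)) [RHS]big_mkcond.
apply: eq_bigr => k _; rewrite vertex_ofK //.
by case: ltnP => // /F0.
Qed.

Section Labels.
Variables (c1 : 'I_n -> bitseq) (p t w : nat) (a ad ap : 'I_n -> nat).

Definition vertex_residual (q : nat) (v : 'I_n) : 'F_p :=
  residual n p t w (vrank v) (vrank (perm v)) (a v) (ad v) (ap v)
    (if (vrank v < m)%N then seed n (c1 v) else 0%N)
    [seq (a u, ap u) | u <- ports I v] q.

Lemma spread_claim f fd :
  (\sum_v (norm_term n p (f v) + (if (n + vrank v < 2 ^ m)%N then norm_term n p (fd v) else 0)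
      - (2 ^ m)%:R * (seeds c1 seed (vrank v))%:R ^+ 2) == 0) &&
  (\sum_v (corr_term n p t (vrank v) (f v)
      + (if (n + vrank v < 2 ^ m)%N then corr_term n p t (n + vrank v)%N (fd v) else 0)
      - (2 ^ m)%:R * ((seeds c1 seed (vrank v))%:R * t%:R ^+ vrank v)) == 0)
  = claim_ok p m (seed_cap n) (seeds c1 seed) (spread f fd) t.
Proof.
rewrite !sumrB (sum_spread (fun _ x => norm_term n p x)) (sum_spread (fun i x => corr_term n p t i x)).
rewrite -!mulr_sumr.
rewrite (sum_seeds (F := fun k => (seeds c1 seed k)%:R ^+ 2)); last first.
  by move=> k mk; rewrite /seeds ltnNge mk /= expr2 mulr0.
rewrite (sum_seeds (F := fun k => (seeds c1 seed k)%:R * t%:R ^+ k)); last first.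
  by move=> k mk; rewrite /seeds ltnNge mk /= mul0r.
by rewrite !subr_eq0.
Qed.

Lemma sum_residual_own :
  (\sum_v vertex_residual 0 v == 0) && (\sum_v vertex_residual 1 v == 0)
  = claim_ok p m (seed_cap n) (seeds c1 seed) (spread a ad) t.
Proof.
rewrite -spread_claim; congr (_ && _); congr (_ == _); apply: eq_bigr => v _;
  by rewrite /vertex_residual /residual /= /seeds vrankK.
Qed.

(** Node [v] speaks for the rank of its image, so reindexing along the permutation gives an ordinary
    claim vector. Extra claims and seeds stay with [v]; only the first summand is moved. *)
Lemma sum_residual_perm :
  (\sum_v vertex_residual 2 v == 0) && (\sum_v vertex_residual 3 v == 0)
  = claim_ok p m (seed_cap n) (seeds c1 seed) (spread (fun v => ap (perm^-1%g v)) ad) t.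
Proof.
have move_perm (F : nat -> nat -> 'F_p) (E : 'I_n -> 'F_p) :
    \sum_v (F (vrank (perm v)) (ap v) + E v) = \sum_v (F (vrank v) (ap (perm^-1%g v)) + E v).
  rewrite !big_split /= [X in _ = X + _](reindex_inj (@perm_inj _ perm)).
  by congr (_ + _); apply: eq_bigr => v _; rewrite permK.
rewrite -spread_claim; under [X in _ = (X == 0) && _]eq_bigr do rewrite -addrA.
under [X in _ = _ && (X == 0)]eq_bigr do rewrite -addrA.
rewrite -(move_perm (fun _ x => norm_term n p x)) -(move_perm (fun i x => corr_term n p t i x)).
congr (_ && _); congr (_ == _); apply: eq_bigr => v _;
  by rewrite /vertex_residual /residual /= /seeds vrankK addrA.
Qed.

Lemma sum_residual_finger :
  \sum_v vertex_residual 4 v = \sum_v \sum_(u | adj I v u)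
    (w%:R ^+ pair_exponent n (ap v) (ap u) - w%:R ^+ pair_exponent n (a v) (a u)).
Proof.
by apply: eq_bigr => v _; rewrite /vertex_residual /residual /= big_map sum_ports.
Qed.
End Labels.
End Sums.
End Instance.

(** * Acceptance *)

Section Acceptance.
Import GRing.Theory.
Local Open Scope ring_scope.
Variables (cst n : nat) (I : instance n).
Hypothesis valid : valid_instance cst I.
Notation L := (ell dsym_protocol n).
Variables (Pr : prover5 n L) (c1 c2 : coins n L).

Let fld2 (k : nat) (v : 'I_n) : nat := field_at (field_width n) (pm2 Pr c1 v) k.
Let fld3 (k : nat) (v : 'I_n) : nat := field_at (field_width n) (pm3 Pr c1 c2 v) k.
Let coin2 : bitseq := val (c2 (vertex_of valid 0)).

Definition globals_agree : Prop := forall v,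
  [/\ fld3 0 v = prime_index n coin2, fld3 1 v = corr_point n coin2
    & fld3 2 v = finger_point n coin2].

Definition balanced : Prop := forall q v, (q < 5)%N ->
  vertex_residual I (fun v => val (c1 v)) (challenge_prime n (prime_index n coin2))
    (corr_point n coin2) (finger_point n coin2) (fld2 0) (fld2 1) (fld2 2) q v
  + inflow (adj I) (fld3 3) (fld3 4) (fun u => (fld3 (5 + q) u)%:R) v
  = outflow (adj I) (fld3 3) (fld3 4) (fun u => (fld3 (5 + q) u)%:R) v.

(** Neighbours compare the announced challenges and the node of rank 0 compares them with its coins;
    connectivity spreads the agreement to all nodes. *)
Lemma all_acceptP :
  (forall v, node_accepts I Pr c1 c2 v) <-> globals_agree /\ balanced.
Proof.
have [n0 [adj_sym [_ [adj_conn [ids_inj [_ ports_adj]]]]]] := valid.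
have memp v u : (u \in ports I v) = adj I v u.
  by rewrite (perm_mem (ports_adj v)) mem_filter mem_enum andbT.
have rk0 v : (vrank I v == 0%N) = (v == vertex_of valid 0).
  apply/eqP/eqP => [<-|->]; first by rewrite vrankK.
  by rewrite vertex_ofK.
split.
  move=> acc.
  have step v : [/\ forall u, adj I v u -> [/\ fld3 0 u = fld3 0 v, fld3 1 u = fld3 1 v & fld3 2 u = fld3 2 v],
     v == vertex_of valid 0 -> [/\ fld3 0 v = prime_index n coin2, fld3 1 v = corr_point n coin2
       & fld3 2 v = finger_point n coin2]
     & forall q, (q < 5)%N -> vertex_residual I (fun v => val (c1 v)) (challenge_prime n (fld3 0 v))
        (fld3 1 v) (fld3 2 v) (fld2 0) (fld2 1) (fld2 2) q v
      + inflow (adj I) (fld3 3) (fld3 4) (fun u => (fld3 (5 + q) u)%:R) v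
      = outflow (adj I) (fld3 3) (fld3 4) (fun u => (fld3 (5 + q) u)%:R) v].
    have := acc v; rewrite /node_accepts /= /dsym_decide => /and3P [h1 h2 h3]; split.
    - move=> u vu; move: h1; rewrite all_map => /allP /(_ u); rewrite memp => /(_ vu) /=.
      by move/and3P => [/eqP ? /eqP ? /eqP ?].
    - move=> e; move: h2; rewrite -/(vrank I v) rk0 e /=; move/eqP: e => ->.
      by move/and3P => [/eqP ? /eqP ? /eqP ?].
    - move=> q q5; move/allP: h3 => /(_ q); rewrite mem_iota => /(_ q5) /eqP.
      rewrite !big_map !(sum_ports valid) -map_comp (pi_on_ids_id valid) /=.
      exact.
  have glob : globals_agree.
    move=> v; have /connectP [s ps ->] := adj_conn (vertex_of valid 0) v.
    elim/last_ind: s ps => [|s x IH]; first by move=> _; have [_ /(_ (eqxx _))] := step (vertex_of valid 0).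
    rewrite rcons_path last_rcons => /andP [/IH [<- <- <-]]; have [H _ _] := step (last (vertex_of valid 0) s).
    exact: H.
  split=> // q v q5; have [_ _ H] := step v; have [<- <- <-] := glob v; exact: H.
move=> [glob bal] v.
have globE u : [/\ field_at (field_width n) (pm3 Pr c1 c2 u) 0 = prime_index n coin2,
  field_at (field_width n) (pm3 Pr c1 c2 u) 1 = corr_point n coin2
  & field_at (field_width n) (pm3 Pr c1 c2 u) 2 = finger_point n coin2] := glob u.
rewrite /node_accepts /= /dsym_decide; apply/and3P; split.
- rewrite all_map; apply/allP => u _ /=.
  by have [-> -> ->] := globE v; have [-> -> ->] := globE u; rewrite !eqxx.
- rewrite -/(vrank I v) rk0; apply/implyP => /eqP ->.
  by have [-> -> ->] := globE (vertex_of valid 0); rewrite !eqxx.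
- apply/allP => q; rewrite mem_iota => q5; apply/eqP.
  rewrite !big_map !(sum_ports valid) -map_comp (pi_on_ids_id valid) /=.
  by have := bal q v q5; have [<- <- <-] := glob v.
Qed.
End Acceptance.

(** * The fingerprint polynomial *)

Definition coin_get n L (v : 'I_n) (o a : nat) (c : coins n L) : 'I_(2 ^ a) :=
  Ordinal (slice_lt o a (val (c v))).

(** Overwriting preserves the length when [o + a <= L], so [insubd] then never falls back to its
    default. *)
Definition coin_set n L (v : 'I_n) (o a : nat) (c : coins n L) (x : 'I_(2 ^ a)) : coins n L :=
  [ffun u => if u == v then insubd (c u) (set_slice o a (val (c u)) x) else c u].

Arguments coin_get {n L} v o a c.
Arguments coin_set {n L} v o a c x.

Section CoinLens.
Variables (n L : nat) (v : 'I_n) (o a : nat).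
Hypothesis oaL : o + a <= L.

Lemma coin_setE (c : coins n L) x : val (coin_set v o a c x v) = set_slice o a (val (c v)) x.
Proof. by rewrite ffunE eqxx val_insubd size_set_slice size_tuple ?eqxx. Qed.

Lemma coin_setNE (c : coins n L) x u : u != v -> coin_set v o a c x u = c u.
Proof. by rewrite ffunE => /negbTE ->. Qed.

Lemma coin_get_set (c : coins n L) x : coin_get v o a (coin_set v o a c x) = x.
Proof. by apply: val_inj; rewrite /= coin_setE slice_set // size_tuple. Qed.

Lemma coin_set_set (c : coins n L) x y : coin_set v o a (coin_set v o a c x) y = coin_set v o a c y.
Proof.
apply/ffunP => u; have [->|uv] := eqVneq u v; last by rewrite !coin_setNE.
by apply: val_inj; rewrite !coin_setE set_slice_set // size_tuple.
Qed.

Lemma coin_set_get (c : coins n L) : coin_set v o a c (coin_get v o a c) = c.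
Proof.
apply/ffunP => u; have [->|uv] := eqVneq u v; last by rewrite coin_setNE.
by apply: val_inj; rewrite coin_setE set_slice_id // size_tuple.
Qed.

Lemma coin_slice_other (c : coins n L) x u o' a' : (u != v) || (o' + a' <= o) || (o + a <= o') ->
  slice o' a' (val (coin_set v o a c x u)) = slice o' a' (val (c u)).
Proof.
have [->|uv _] := eqVneq u v; last by rewrite coin_setNE.
by move=> /= H; rewrite coin_setE slice_set_other // size_tuple.
Qed.
End CoinLens.

(** A slice of one node's coins is uniform and independent of everything else that [E] reads. *)
Lemma coin_count n L (v : 'I_n) o a (E : coins n L -> 'I_(2 ^ a) -> bool) k :
  o + a <= L ->
  (forall c x y, E (coin_set v o a c x) y = E c y) ->
  (forall c, #|[set x | E c x]| <= k) ->
  #|[set c | E c (coin_get v o a c)]| * 2 ^ a <= k * #|{: coins n L}|.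
Proof.
move=> oaL Einv Ek; rewrite -[X in _ * X <= _]card_ord.
apply: (@lens_count _ _ (coin_get v o a) (fun c x => coin_set v o a c x) E) => //.
- exact: coin_get_set.
- exact: coin_set_set.
- exact: coin_set_get.
Qed.

(** Averages a bound that holds for each fixed outcome of the first round. *)
Lemma card_pairs_le (A B : finType) (E : A -> B -> bool) q k :
  (forall x, #|[set y | E x y]| * q <= k * #|B|) ->
  #|[set z : A * B | E z.1 z.2]| * q <= k * (#|A| * #|B|).
Proof.
move=> H; rewrite -sum1dep_card -(pair_big_dep xpredT (fun x y => E x y) (fun _ _ => 1)) /=.
rewrite big_distrl /= mulnCA -sum_nat_const; apply: leq_sum => x _.
by rewrite sum1dep_card.
Qed.

Section Fingerprint.
Import GRing.Theory.
Local Open Scope ring_scope.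
Variables (cst n : nat) (I : instance n).
Hypothesis valid : valid_instance cst I.
Notation L := (ell dsym_protocol n).
Notation m := (cube_dim n).
Notation perm := (Defs.perm_in I).
Notation O := (coins n L).

Definition vseeds (g : nat -> bitseq -> nat) (c : O) : nat -> nat :=
  seeds valid (fun v => val (c v)) g.

Lemma seed1_lt c : (seed1 n c < seed_range n)%N. Proof. exact: slice_lt. Qed.
Lemma seed2_lt c : (seed2 n c < seed_range n)%N. Proof. exact: slice_lt. Qed.

Lemma vseeds1_lt c k : (vseeds seed1 c k < seed_range n)%N.
Proof. by rewrite /vseeds /seeds; case: ifP => _; [apply: seed1_lt | rewrite expn_gt0]. Qed.
Lemma vseeds2_lt c k : (vseeds seed2 c k < seed_range n)%N.
Proof. by rewrite /vseeds /seeds; case: ifP => _; [apply: seed2_lt | rewrite expn_gt0]. Qed.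

Definition code (c : O) : nat -> nat := weight m (seed_cap n) (vseeds seed c).
Definition code1 (c : O) : nat -> nat := weight m (seed_range n) (vseeds seed1 c).
Definition code2 (c : O) : nat -> nat := weight m (seed_range n) (vseeds seed2 c).

Lemma codeE c i : code c i = (code1 c i + radix n * code2 c i)%N.
Proof.
rewrite /code -(weight_split i (vseeds1_lt c) (vseeds2_lt c)).
have zE k : vseeds seed c k = (vseeds seed1 c k + radix n * vseeds seed2 c k)%N.
  by rewrite /vseeds /seeds; case: (k < m)%N; rewrite ?muln0.
by apply: eq_bigr => k _; rewrite zE.
Qed.

Lemma code1_lt c i : (code1 c i < radix n)%N.
Proof. exact/weight_lt_radix/vseeds1_lt. Qed.
Lemma code2_lt c i : (code2 c i < radix n)%N.
Proof. exact/weight_lt_radix/vseeds2_lt. Qed.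

Lemma code_lt c i : (code c i < 2 ^ field_width n)%N.
Proof.
rewrite codeE; rewrite -(weight_split i (vseeds1_lt c) (vseeds2_lt c)).
exact: weight_lt_field (vseeds1_lt c) (vseeds2_lt c).
Qed.

Lemma vseeds_cap c k : (vseeds seed c k <= seed_cap n)%N.
Proof.
rewrite /vseeds /seeds; case: ifP => // _; rewrite /seed /seed_cap.
by rewrite leq_add // ?leq_mul2l ltnW ?orbT // ?seed1_lt ?seed2_lt.
Qed.

Lemma pair_exponent_code c i j :
  pair_exponent n (code c i) (code c j) = (code1 c i + radix n * code2 c j)%N.
Proof.
rewrite /pair_exponent !codeE; congr (_ + _ * _)%N.
  by rewrite addnC mulnC modnMDl modn_small ?code1_lt.
by rewrite addnC mulnC divnMDl ?radix_gt0 // divn_small ?code1_lt // addn0.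
Qed.

Definition adj_diff (p : nat) (v u : 'I_n) : 'F_p :=
  (adj I (perm^-1%g v) (perm^-1%g u))%:R - (adj I v u)%:R.

Definition finger_poly (p : nat) (c : O) : {poly 'F_p} :=
  \sum_v \sum_u (adj_diff p v u)%:P
     * ('X^(code1 c (vrank I v)) * 'X^(radix n * code2 c (vrank I u))).

(** Reindexing the image terms along the permutation moves it onto the adjacency matrix, so both
    families share the monomials and their coefficients subtract. *)
Lemma finger_polyE p w c :
  \sum_v \sum_(u | adj I v u)
    (w ^+ pair_exponent n (code c (vrank I (perm v))) (code c (vrank I (perm u)))
     - w ^+ pair_exponent n (code c (vrank I v)) (code c (vrank I u)))
  = (finger_poly p c).[w].
Proof.
pose F v u : 'F_p := w ^+ pair_exponent n (code c (vrank I v)) (code c (vrank I u)).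
transitivity (\sum_v \sum_u (adj I v u)%:R * F (perm v) (perm u)
    - \sum_v \sum_u (adj I v u)%:R * F v u).
  rewrite -sumrB; apply: eq_bigr => v _; rewrite -sumrB big_mkcond; apply: eq_bigr => u _.
  by case: ifP => _; rewrite ?mul1r // !mul0r subr0.
have -> : \sum_v \sum_u (adj I v u)%:R * F (perm v) (perm u)
    = \sum_v \sum_u (adj I (perm^-1%g v) (perm^-1%g u))%:R * F v u.
  rewrite [RHS](reindex_inj (@perm_inj _ perm)); apply: eq_bigr => v _.
  rewrite [RHS](reindex_inj (@perm_inj _ perm)); apply: eq_bigr => u _.
  by rewrite !permK.
rewrite /finger_poly horner_sum -sumrB; apply: eq_bigr => v _.
rewrite horner_sum -sumrB; apply: eq_bigr => u _.
by rewrite -mulrBl hornerCM hornerM !hornerXn -exprD /F pair_exponent_code.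
Qed.

Lemma finger_poly_size p c : (size (finger_poly p c) <= radix n * radix n)%N.
Proof.
rewrite /finger_poly.
have r0 := radix_gt0 n.
apply: leq_trans (size_sum _ _ _) _; apply/bigmax_leqP => v _.
apply: leq_trans (size_sum _ _ _) _; apply/bigmax_leqP => u _.
rewrite mul_polyC; apply: leq_trans (size_scale_leq _ _) _.
rewrite -exprD size_polyXn.
have := code1_lt c (vrank I v); have := code2_lt c (vrank I u).
set x := code1 _ _; set y := code2 _ _; nia.
Qed.

Definition diff_entry (p i j : nat) : {poly 'F_p} :=
  if (i < n)%N && (j < n)%N then (adj_diff p (vertex_of valid i) (vertex_of valid j))%:P else 0.

(** The multiplicative form of one summand of [weight], with the code in the exponent. *)
Definition seed_factor (R : pzRingType) (x : R) (k : nat) (s : 'I_(2 ^ seed_width n)) (b : bool) : R :=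
  x ^+ (if b then seed_range n - s else seed_range n + s)%N.

Definition get1 (k : nat) (c : O) := coin_get (vertex_of valid k) 0 (seed_width n) c.
Definition get2 (k : nat) (c : O) :=
  coin_get (vertex_of valid k) (seed_width n) (seed_width n) c.
Definition set1 (k : nat) (c : O) := coin_set (vertex_of valid k) 0 (seed_width n) c.
Definition set2 (k : nat) (c : O) :=
  coin_set (vertex_of valid k) (seed_width n) (seed_width n) c.

(** Row [i] of the difference matrix folded with the second seeds alone; folding the rows with the
    first seeds yields [finger_poly]. *)
Definition half_finger (p : nat) (c : O) (i : nat) : {poly 'F_p} :=
  multilinear m (fun k => seed_factor ('X^(radix n)) k (get2 k c)) (diff_entry p i).

Lemma sum_cube (V : nmodType) (F : nat -> V) : (forall i, (n <= i)%N -> F i = 0) ->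
  \sum_v F (vrank I v) = \sum_(i < 2 ^ m) F i.
Proof.
move=> F0; rewrite (sum_vrank valid).
under eq_bigr do rewrite (vertex_ofK valid) //.
rewrite (big_ord_widen (2 ^ m) F (cube_dim_ge n)) big_mkcond; apply: eq_bigr => i _.
by case: ltnP => // /F0.
Qed.

Lemma half_fingerE p c i : half_finger p c i
  = \sum_(j < 2 ^ m) diff_entry p i j * 'X^(radix n * code2 c j).
Proof.
rewrite /half_finger multilinearE; apply: eq_bigr => j _; congr (_ * _).
rewrite /code2 /weight exprM -prodrXr; apply: eq_bigr => k _.
by rewrite /seed_factor /vseeds /seeds ltn_ord /= /seed2.
Qed.

Lemma finger_poly_multilinear p c : finger_poly p c
  = multilinear m (fun k => seed_factor 'X k (get1 k c)) (half_finger p c).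
Proof.
rewrite multilinearE.
have -> : \sum_(i < 2 ^ m) half_finger p c i * \prod_(k < m) seed_factor 'X k (get1 k c) (bit k i)
  = \sum_(i < 2 ^ m) (\sum_(j < 2 ^ m) diff_entry p i j * 'X^(radix n * code2 c j)) * 'X^(code1 c i).
  apply: eq_bigr => i _; rewrite half_fingerE; congr (_ * _).
  rewrite /code1 /weight -prodrXr; apply: eq_bigr => k _.
  by rewrite /seed_factor /vseeds /seeds ltn_ord /= /seed1.
rewrite -(sum_cube (F := fun i =>
  (\sum_(j < 2 ^ m) diff_entry p i j * 'X^(radix n * code2 c j)) * 'X^(code1 c i))); last first.
  move=> i ni; rewrite big1 ?mul0r // => j _.
  by rewrite /diff_entry ltnNge ni mul0r.
apply: eq_bigr => v _; rewrite -(sum_cube (F := fun j =>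
  diff_entry p (vrank I v) j * 'X^(radix n * code2 c j))); last first.
  by move=> j nj; rewrite /diff_entry [(j < n)%N]ltnNge nj andbF mul0r.
rewrite big_distrl /=; apply: eq_bigr => u _.
by rewrite /diff_entry !(vrank_lt valid) !vrankK -mulrA [X in _ * X]mulrC.
Qed.

Lemma cube_dim_lt k : (k < m)%N -> (k < n)%N.
Proof. by move=> km; apply: leq_trans km (cube_dim_leq n). Qed.

Lemma widths : (seed_width n + seed_width n <= L)%N.
Proof. by rewrite /= /field_width /point_width /seed_width; lia. Qed.

Lemma seed_factor_root (F : fieldType) (b : nat) k (d0 d1 : {poly F}) : (0 < b)%N ->
  (d0 != 0) || (d1 != 0) ->
  (#|[set x | (seed_factor ('X^b : {poly F}) k x false * d0
       + seed_factor 'X^b k x true * d1 == 0)%R]| <= 1)%N.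
Proof.
move=> b0; apply: (@power_pair_root _ ('X^b : {poly F}) (2 ^ seed_width n) (seed_range n)).
- by rewrite monic_neq0 ?monicXn.
- move=> i j /(congr1 (fun f : {poly F} => size f)); rewrite -!exprM !size_polyXn => -[].
  by move/eqP; rewrite eqn_pmul2l // => /eqP.
- exact: leqnSn.
Qed.

Lemma vertex_of_neq k l : (k < m)%N -> (l < m)%N -> k != l ->
  vertex_of valid l != vertex_of valid k.
Proof.
move=> km lm; apply: contraNneq => e.
by rewrite (vertex_of_inj (cube_dim_lt lm) (cube_dim_lt km) e).
Qed.

(** Schwartz-Zippel is applied twice: the second seeds rarely kill a fixed nonzero row, and the
    first seeds rarely kill a nonzero vector of folded rows. *)
Lemma finger_poly_eq0 p : prime p -> ~ DSym I ->
  (#|[set c : O | finger_poly p c == 0%R]| * 2 ^ seed_width n <= 2 * m * #|{: O}|)%N.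
Proof.
move=> pp nD.
have [v0 [u0 d0]] : exists v u, adj_diff p v u != 0.
  have [/existsP [v /existsP [u H]]|H] :=
      boolP [exists v, exists u, adj I v u != adj I (perm v) (perm u)].
    exists (perm v), (perm u); rewrite /adj_diff !permK.
    by move: H; case: (adj I v u); case: (adj I _ _) => //= _;
      rewrite ?subr0 ?sub0r ?oppr_eq0 oner_eq0.
  case: nD => v u; apply/eqP; move: H; rewrite negb_exists => /forallP /(_ v).
  by rewrite negb_exists => /forallP /(_ u); rewrite negbK.
pose i0 := Ordinal (leq_trans (vrank_lt valid v0) (cube_dim_ge n)).
pose j0 := Ordinal (leq_trans (vrank_lt valid u0) (cube_dim_ge n)).
have e0 : diff_entry p i0 j0 != 0.
  by rewrite /diff_entry /= !(vrank_lt valid) /= !vrankK polyC_eq0.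
have bA : (#|[set c : O | half_finger p c i0 == 0%R]| * 2 ^ seed_width n <= m * #|{: O}|)%N.
  have := @schwartz_zippel {poly 'F_p} O (2 ^ seed_width n) m get2 set2
    (seed_factor ('X^(radix n))) (fun _ => diff_entry p i0).
  rewrite (_ : [set c | [exists i : 'I_(2 ^ m), diff_entry p i0 i != 0%R] && _]
     = [set c : O | half_finger p c i0 == 0%R]); last first.
    by apply/setP => c; rewrite !inE (introT existsP) //; exists j0.
  apply=> //.
  - by move=> k c x _; apply: coin_get_set widths _ _.
  - by move=> k c x y _; apply: coin_set_set widths _ _ _.
  - by move=> k c _; apply: coin_set_get widths _.
  - move=> k l c x km lm kl; apply: val_inj; rewrite /= coin_slice_other ?widths //.
    by rewrite vertex_of_neq.
  - by move=> k d d' H; apply: seed_factor_root (radix_gt0 n) H.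
have bB : (#|[set c : O | [exists i : 'I_(2 ^ m), half_finger p c i != 0%R]
     && (finger_poly p c == 0%R)]| * 2 ^ seed_width n <= m * #|{: O}|)%N.
  have w1 : (0 + seed_width n <= L)%N by apply: leq_trans widths; apply: leq_addr.
  under eq_finset do rewrite finger_poly_multilinear.
  apply: (@schwartz_zippel {poly 'F_p} O (2 ^ seed_width n) m get1 set1
    (seed_factor 'X) (half_finger p)).
  - by move=> k c x _; apply: coin_get_set w1 _ _.
  - by move=> k c x y _; apply: coin_set_set w1 _ _ _.
  - by move=> k c _; apply: coin_set_get w1 _.
  - move=> k l c x km lm kl; apply: val_inj; rewrite /= coin_slice_other //.
    by rewrite vertex_of_neq.
  (* The folded rows read only the second slices, which resampling a first slice leaves intact. *)
  - move=> k c x i km; rewrite !half_fingerE; apply: eq_bigr => j _; congr (_ * 'X^(_ * _)).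
    apply: eq_bigr => l _; rewrite /vseeds /seeds ltn_ord /seed2.
    by rewrite coin_slice_other // leqnn !orbT.
  - by move=> k d d' H; apply: (@seed_factor_root _ 1).
rewrite -mulnA mul2n -addnn.
apply: leq_trans (leq_add bA bB); rewrite -mulnDl leq_mul2r; apply/orP; right.
apply: leq_trans (leq_card_setU _ _); apply/subset_leq_card/subsetP => c.
rewrite !inE => fp; rewrite fp andbT; case: eqP => //= /eqP h.
by apply/existsP; exists i0.
Qed.
End Fingerprint.

(** * Soundness *)

(** The counterpart for a fixed second round, needed where the prime must be fixed before the seeds
    vary. *)
Lemma card_pairs_le_r (A B : finType) (E : A -> B -> bool) q k :
  (forall y, #|[set x | E x y]| * q <= k * #|A|) ->
  #|[set z : A * B | E z.1 z.2]| * q <= k * (#|A| * #|B|).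
Proof.
move=> H; rewrite -sum1dep_card -(pair_big_dep xpredT (fun x y => E x y) (fun _ _ => 1)) /=.
rewrite (exchange_big_dep xpredT) //= big_distrl /= [#|A| * _]mulnC mulnCA -sum_nat_const.
by apply: leq_sum => y _; rewrite sum1dep_card.
Qed.

Lemma card_dividing_challenges n Q e : 0 < Q -> Q <= 2 ^ e ->
  #|[set j : 'I_(2 ^ index_width n) | challenge_prime n j %| Q]| <= e.
Proof.
move=> Q0 Qe; rewrite -(@leq_exp2l 2) //; apply: leq_trans Qe.
pose s := [seq challenge_prime n j | j : 'I_(2 ^ index_width n)].
apply: leq_trans (@count_prime_divisors s Q _ _ Q0).
- rewrite leq_exp2l // /s count_map -sum1_card -sum1_count big_enum_cond /=.
  by rewrite leq_eqVlt; apply/orP; left; apply/eqP/eq_bigl => j; rewrite inE.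
- rewrite map_inj_uniq ?enum_uniq // => i j /challenge_prime_inj H; apply: val_inj.
  by apply: H; apply: ltn_ord.
- by apply/allP => _ /mapP [j _ ->]; have [] := challenge_primeP (ltn_ord j).
Qed.

(** [x1] is at most [T / 16] and each of the other five at most [T / 64]; three times their sum is
    at most [27 / 64] of [T]. *)
Lemma six_event_union_bound l m w T x1 x2 x2' x3 x3' x4 r :
  0 < T -> m + 2 <= 2 ^ l -> m + w + w <= 97 * 2 ^ l -> r * r = 2 ^ (4 * l + 14) ->
  x1 * 2 ^ (l + 5) <= 2 * m * T ->
  x2 * 2 ^ (l + 13) <= (m + w + w) * T -> x2' * 2 ^ (l + 13) <= (m + w + w) * T ->
  x3 * 2 ^ (4 * l + 20) <= m * T -> x3' * 2 ^ (4 * l + 20) <= m * T ->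
  x4 * 2 ^ (4 * l + 20) <= r * r * T ->
  3 * (x1 + x2 + x2' + x3 + x3' + x4) < T.
Proof.
move=> T0 ml wl -> h1 h2 h2' h3 h3' h4.
have cancel k j x a : a <= 2 ^ k -> x * 2 ^ (k + j) <= a * T -> x * 2 ^ j <= T.
  move=> ak xa; have k0 : 0 < 2 ^ k by rewrite expn_gt0.
  rewrite -(leq_pmul2l k0) mulnCA -expnD; apply: leq_trans xa _.
  by rewrite leq_mul2r ak orbT.
have e1 : x1 * 2 ^ 4 <= T.
  by apply: (cancel (l + 1) 4 _ (2 * m)); [rewrite expnD; lia | rewrite -addnA].
have m4 : m <= 2 ^ (4 * l + 14).
  by apply: leq_trans (_ : 2 ^ l <= _); [lia | rewrite leq_exp2l //; lia].
have e2 : x2 * 2 ^ 6 <= T by apply: (cancel (l + 7) 6 _ (m + w + w)); [rewrite expnD; lia | rewrite -addnA].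
have e2' : x2' * 2 ^ 6 <= T by apply: (cancel (l + 7) 6 _ (m + w + w)); [rewrite expnD; lia | rewrite -addnA].
have e3 : x3 * 2 ^ 6 <= T by apply: (cancel (4 * l + 14) 6 _ m); [| rewrite -addnA].
have e3' : x3' * 2 ^ 6 <= T by apply: (cancel (4 * l + 14) 6 _ m); [| rewrite -addnA].
have e4 : x4 * 2 ^ 6 <= T by apply: (cancel (4 * l + 14) 6 _ (2 ^ (4 * l + 14))); [| rewrite -addnA].
lia.
Qed.

Section Soundness.
Import GRing.Theory.
Local Open Scope ring_scope.
Variables (cst n : nat) (I : instance n).
Hypothesis valid : valid_instance cst I.
Notation L := (ell dsym_protocol n).
Notation m := (cube_dim n).
Notation W := (field_width n).
Notation perm := (Defs.perm_in I).
Notation O := (coins n L).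

Let leader : 'I_n := vertex_of valid 0.
Let pj (c2 : O) : nat := challenge_prime n (prime_index n (val (c2 leader))).
Let tp (c2 : O) : nat := corr_point n (val (c2 leader)).
Let wp (c2 : O) : nat := finger_point n (val (c2 leader)).

Lemma pjP c2 : [/\ prime (pj c2), (2 ^ point_width n <= pj c2)%N & (pj c2 < 2 ^ W)%N].
Proof. exact/challenge_primeP/slice_lt. Qed.

Section BadClaims.
Variable A : O -> nat -> nat.
Hypothesis A_lt : forall c i, (A c i < 2 ^ W)%N.

Definition claim_error (c : O) : nat := sq_dist m (A c) (code valid c).

(** The claims depend only on the first coins, so the integer is fixed before the prime is drawn; it
    is at most [2 ^ (m + W + W)] and has few prime divisors. *)
Lemma card_bad_prime :
  (#|[set z : O * O | (claim_error z.1 != 0%N) && (pj z.2 %| claim_error z.1)%N]|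
    * 2 ^ index_width n <= (m + W + W) * (#|{: O}| * #|{: O}|))%N.
Proof.
refine (@card_pairs_le O O (fun c1 c2 => (claim_error c1 != 0%N) && (pj c2 %| claim_error c1)%N) _ _ _) => c1.
apply: (@coin_count n L leader 0 (index_width n)
   (fun _ j => (claim_error c1 != 0%N) && (challenge_prime n j %| claim_error c1)%N)) => //.
  by rewrite /= /index_width /field_width /point_width; lia.
move=> _; have [->|Q0] := posnP (claim_error c1).
  by rewrite (_ : [set j | _] = set0) ?cards0 //; apply/setP => j; rewrite !inE.
have Qle : (claim_error c1 <= 2 ^ (m + W + W))%N.
  by apply: sq_dist_bound => i; [apply: A_lt | apply: code_lt].
apply: leq_trans (card_dividing_challenges n Q0 Qle); apply/subset_leq_card/subsetP => j.
by rewrite !inE => /andP[].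
Qed.

(** Prime and point come from disjoint slices of the leader's coins, so the point is still uniform
    once the prime is fixed. *)
Lemma card_bad_point :
  (#|[set z : O * O | ~~ (pj z.2 %| claim_error z.1)%N
      && claim_ok (pj z.2) m (seed_cap n) (vseeds valid seed z.1) (A z.1) (tp z.2)]|
    * 2 ^ point_width n <= m * (#|{: O}| * #|{: O}|))%N.
Proof.
refine (@card_pairs_le O O (fun c1 c2 => ~~ (pj c2 %| claim_error c1)%N
  && claim_ok (pj c2) m (seed_cap n) (vseeds valid seed c1) (A c1) (tp c2)) _ _ _) => c1.
have wL : (index_width n + point_width n <= L)%N.
  by rewrite /= /index_width /field_width /point_width; lia.
apply: (@coin_count n L leader (index_width n) (point_width n) (fun c2 t =>
  ~~ (pj c2 %| claim_error c1)%N
  && claim_ok (pj c2) m (seed_cap n) (vseeds valid seed c1) (A c1) t)) => //.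
  move=> c x y; suff -> : pj (coin_set leader (index_width n) (point_width n) c x) = pj c by [].
  by rewrite /pj /prime_index coin_slice_other // add0n leqnn orbT.
move=> c2; have [pp pT _] := pjP c2; have [|nQ] := boolP (pj c2 %| claim_error c1)%N.
  by move=> _; rewrite (_ : [set j | _] = set0) ?cards0 //; apply/setP => j; rewrite !inE.
exact: claim_sound pp pT (vseeds_cap valid c1) nQ.
Qed.
End BadClaims.

Lemma card_bad_poly : ~ DSym I ->
  (#|[set z : O * O | finger_poly valid (pj z.2) z.1 == 0%R]| * 2 ^ seed_width n
    <= 2 * m * (#|{: O}| * #|{: O}|))%N.
Proof.
move=> nD; refine (@card_pairs_le_r O O (fun c1 c2 => finger_poly valid (pj c2) c1 == 0) _ _ _) => c2.
by apply: finger_poly_eq0 nD; have [] := pjP c2.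
Qed.

Lemma card_bad_root :
  (#|[set z : O * O | (finger_poly valid (pj z.2) z.1 != 0%R)
      && root (finger_poly valid (pj z.2) z.1) (wp z.2)%:R]| * 2 ^ point_width n
    <= radix n * radix n * (#|{: O}| * #|{: O}|))%N.
Proof.
refine (@card_pairs_le O O (fun c1 c2 => (finger_poly valid (pj c2) c1 != 0)
      && root (finger_poly valid (pj c2) c1) (wp c2)%:R) _ _ _) => c1.
have wL : (index_width n + point_width n + point_width n <= L)%N.
  by rewrite /= /index_width /field_width /point_width; lia.
apply: (@coin_count n L leader (index_width n + point_width n) (point_width n) (fun c2 w =>
  (finger_poly valid (pj c2) c1 != 0) && root (finger_poly valid (pj c2) c1) w%:R)) => //.
  move=> c x y; suff -> : pj (coin_set leader (index_width n + point_width n) (point_width n) c x) = pj c by [].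
  by rewrite /pj /prime_index coin_slice_other // add0n leq_addr orbT.
move=> c2; have [pp pT _] := pjP c2; have [->|f0] := eqVneq (finger_poly valid (pj c2) c1) 0.
  by rewrite (_ : [set j | _] = set0) ?cards0 //; apply/setP => j; rewrite !inE.
apply: leq_trans (finger_poly_size valid (pj c2) c1).
exact/ltnW/card_roots_small.
Qed.

Lemma dsym_sound (Pr : prover5 n L) : ~ DSym I -> (3 * n_accept I Pr < n_total n L)%N.
Proof.
move=> nD.
pose fld2 k c v := field_at W (pm2 Pr c v) k.
pose own c := spread valid (fld2 0%N c) (fld2 1%N c).
pose twisted c := spread valid (fun v => fld2 2 c (perm^-1%g v)) (fld2 1%N c).
have own_lt c i : (own c i < 2 ^ W)%N by rewrite /own /spread; case: ifP => _; apply: field_at_lt.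
have twisted_lt c i : (twisted c i < 2 ^ W)%N.
  by rewrite /twisted /spread; case: ifP => _; apply: field_at_lt.
rewrite /n_total card_prod.
have T0 : (0 < #|{: O}| * #|{: O}|)%N.
  by rewrite muln_gt0 andbb; apply/card_gt0P; exists [ffun=> [tuple false | _ < L]].
have ml := cube_dim_loglog n.
apply: leq_ltn_trans (six_event_union_bound (l := loglog n) (w := W) (r := radix n) T0 ml _ _
  (card_bad_poly nD) (card_bad_prime own_lt) (card_bad_prime twisted_lt)
  (card_bad_point own) (card_bad_point twisted) card_bad_root); last first.
- by rewrite /radix -expnD /radix_width; congr expn; lia.
(* Here [W + W] is [16 * loglog n + 80], whence the constant 97 = 1 + 16 + 80. *)
- have : (loglog n < 2 ^ loglog n)%N by apply: ltn_expl.
  rewrite /field_width /point_width; lia.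
rewrite leq_mul2l /=.
set B1 := [set z : O * O | finger_poly _ _ _ == 0].
set B2 := [set z : O * O | (claim_error own _ != 0%N) && _].
set B2' := [set z : O * O | (claim_error twisted _ != 0%N) && _].
set B3 := [set z : O * O | ~~ (_ %| claim_error own _)%N && _].
set B3' := [set z : O * O | ~~ (_ %| claim_error twisted _)%N && _].
set B4 := [set z : O * O | _ && root _ _].
apply: leq_trans (_ : (#|B1 :|: B2 :|: B2' :|: B3 :|: B3' :|: B4| <= _)%N); last first.
  do 4!(apply: leq_trans (leq_card_setU _ _) _; rewrite leq_add2r).
  exact: leq_card_setU.
apply/subset_leq_card/subsetP => -[c1 c2]; rewrite inE /= => /forallP acc.
have [_ bal] := (all_acceptP valid Pr c1 c2).1 acc.
have sum0 q : (q < 5)%N -> \sum_v vertex_residual I (fun v => val (c1 v)) (pj c2) (tp c2) (wp c2)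
    (fld2 0%N c1) (fld2 1%N c1) (fld2 2 c1) q v = 0.
  move=> q5; apply: (flow_sound _ (fun v => bal q v q5)); by case: valid => _ [].
have cl_own : claim_ok (pj c2) m (seed_cap n) (vseeds valid seed c1) (own c1) (tp c2).
  by rewrite -(sum_residual_own valid _ _ _ (wp c2) _ _ (fld2 2 c1)) !sum0 ?eqxx.
have cl_tw : claim_ok (pj c2) m (seed_cap n) (vseeds valid seed c1) (twisted c1) (tp c2).
  by rewrite -(sum_residual_perm valid _ _ _ (wp c2) (fld2 0%N c1)) !sum0 ?eqxx.
rewrite !inE /= cl_own cl_tw !andbT.
(* An accepted claim whose error the prime does not divide falls in [B3] or [B3']; a nonzero error
   that it divides falls in [B2] or [B2']. Otherwise both errors are zero. *)
case: (boolP (pj c2 %| claim_error own c1)%N) => /= [_|]; last by rewrite !orbT.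
case: (boolP (pj c2 %| claim_error twisted c1)%N) => /= [_|]; last by rewrite !orbT.
rewrite !andbT.
have [e_own|] := eqVneq (claim_error own c1) 0%N; last by rewrite !orbT.
have [e_tw|] := eqVneq (claim_error twisted c1) 0%N; last by rewrite !orbT.
(* The claims now equal the codes, so the fifth sum is the value of the fingerprint polynomial at
   the drawn point: that polynomial is zero or has a root there. *)
rewrite /= !orbF; case: eqP => //= _; rewrite rootE -finger_polyE.
have rk v : (vrank I v < 2 ^ m)%N by apply: leq_trans (vrank_lt valid v) (cube_dim_ge n).
have ownE v : fld2 0%N c1 v = code valid c1 (vrank I v).
  rewrite -(sq_dist_eq0 e_own (rk v)) /own /spread (vrank_lt valid) vrankK //.
have twE v : fld2 2 c1 v = code valid c1 (vrank I (perm v)).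
  by rewrite -(sq_dist_eq0 e_tw (rk _)) /twisted /spread (vrank_lt valid) vrankK permK.
apply/eqP; rewrite -[RHS](sum0 4 isT) (sum_residual_finger valid).
apply: eq_bigr => v _; apply: eq_bigr => u _.
by rewrite !ownE !twE.
Qed.
End Soundness.

(** * Completeness *)

Section Completeness.
Import GRing.Theory.
Local Open Scope ring_scope.
Variables (cst n : nat) (I : instance n).
Hypothesis valid : valid_instance cst I.
Hypothesis sym : DSym I.
Notation L := (ell dsym_protocol n).
Notation m := (cube_dim n).
Notation W := (field_width n).
Notation perm := (Defs.perm_in I).
Notation O := (coins n L).

Lemma claim_ok_eq p M z a b t : (forall i, (i < 2 ^ m)%N -> a i = b i) ->
  claim_ok p m M z a t = claim_ok p m M z b t.
Proof.
move=> ab; rewrite /claim_ok; congr (_ && _); congr (_ == _); apply: eq_bigr => i _;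
  by rewrite ab.
Qed.

Definition honest2 (c1 : O) (v : 'I_n) : bitseq :=
  pack W [:: code valid c1 (vrank I v); code valid c1 (n + vrank I v);
    code valid c1 (vrank I (perm v))].

Lemma field_honest2 c1 v q : (q < 3)%N -> field_at W (honest2 c1 v) q
  = nth 0%N [:: code valid c1 (vrank I v); code valid c1 (n + vrank I v);
      code valid c1 (vrank I (perm v))] q.
Proof. by move=> q3; rewrite field_pack //= !code_lt. Qed.

Lemma spread_code (c1 : O) i : (i < 2 ^ m)%N ->
  spread valid (fun v => code valid c1 (vrank I v)) (fun v => code valid c1 (n + vrank I v)) i
  = code valid c1 i.
Proof.
move=> im; have n0 : (0 < n)%N by case: valid.
have := leq_trans im (cube_dim_le n0) => i2n.
rewrite /spread; case: ltnP => h; rewrite vertex_ofK ?subnKC //; lia.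
Qed.

(** The first four sums vanish because true codes pass [claim_ok], the fifth because an automorphism
    makes every [adj_diff] zero. *)
Lemma honest_residual (c1 : O) p t w q : prime p -> (q < 5)%N ->
  \sum_v vertex_residual I (fun v => val (c1 v)) p t w
    (fun v => code valid c1 (vrank I v)) (fun v => code valid c1 (n + vrank I v))
    (fun v => code valid c1 (vrank I (perm v))) q v = 0.
Proof.
move=> pp q5.
have ok : claim_ok p m (seed_cap n) (vseeds valid seed c1) (code valid c1) t.
  exact: claim_complete pp (vseeds_cap valid c1).
have := sum_residual_own valid (fun v => val (c1 v)) p t w
  (fun v => code valid c1 (vrank I v)) (fun v => code valid c1 (n + vrank I v))
  (fun v => code valid c1 (vrank I (perm v))).
rewrite (claim_ok_eq _ _ _ _ (spread_code c1)) ok => /andP [/eqP h0 /eqP h1].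
have := sum_residual_perm valid (fun v => val (c1 v)) p t w
  (fun v => code valid c1 (vrank I v)) (fun v => code valid c1 (n + vrank I v))
  (fun v => code valid c1 (vrank I (perm v))).
have tw i : (i < 2 ^ m)%N -> spread valid (fun v => code valid c1 (vrank I (perm (perm^-1%g v))))
    (fun v => code valid c1 (n + vrank I v)) i = code valid c1 i.
  by move=> im; rewrite -[RHS]spread_code // /spread permKV.
rewrite (claim_ok_eq _ _ _ _ tw) ok => /andP [/eqP h2 /eqP h3].
have h4 := sum_residual_finger valid (fun v => val (c1 v)) p t w
  (fun v => code valid c1 (vrank I v)) (fun v => code valid c1 (n + vrank I v))
  (fun v => code valid c1 (vrank I (perm v))).
case: q q5 => [|[|[|[|[|//]]]]] _ //; rewrite {}h4 {h0 h1 h2 h3}.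
rewrite finger_polyE /finger_poly big1 ?horner0 // => v _; rewrite big1 // => u _.
by rewrite /adj_diff sym !permKV subrr mul0r.
Qed.

Lemma eq_vertex_residual c p t w a a' ad ad' ap ap' q v :
  a =1 a' -> ad =1 ad' -> ap =1 ap' ->
  vertex_residual I c p t w a ad ap q v = vertex_residual I c p t w a' ad' ap' q v.
Proof.
move=> ea ed ep; rewrite /vertex_residual ea ed ep; congr (residual _ _ _ _ _ _ _ _ _ _ _ _).
by apply: eq_map => u; rewrite ea ep.
Qed.

Lemma honest3_exists (z : O * O) : exists f : 'I_n -> bitseq,
  (forall v, size (f v) <= L)%N /\
  forall Pr : prover5 n L, pm2 Pr z.1 = honest2 z.1 -> pm3 Pr z.1 z.2 = f ->
    forall v, node_accepts I Pr z.1 z.2 v.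
Proof.
have [n0 [adj_sym [_ [adj_conn _]]]] := valid.
case: z => c1 c2; set coin2 := val (c2 (vertex_of valid 0)).
set j := prime_index n coin2; set t := corr_point n coin2; set w := finger_point n coin2.
set p := challenge_prime n j.
have [pp pT pW] : [/\ prime p, 2 ^ point_width n <= p & p < 2 ^ W]%N.
  exact/challenge_primeP/slice_lt.
have ml := cube_dim_loglog n.
have mT : (64 * (m + 1) < 2 ^ point_width n)%N.
  have -> : (point_width n = 6 + (loglog n + (3 * loglog n + 14)))%N.
    by rewrite /point_width; lia.
  rewrite (expnD 2 6) ltn_mul2l /= expnD; apply: leq_trans (_ : 2 ^ loglog n <= _)%N; first lia.
  by rewrite leq_pmulr // expn_gt0.
have TW : (2 ^ point_width n <= 2 ^ W)%N by rewrite leq_exp2l // /field_width; lia.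
(* The exponent is [m + 1] because the flow needs strictly fewer than [2 ^ k] vertices, while [n]
   may equal [2 ^ m]. *)
have nm : (#|'I_n| < 2 ^ (m + 1))%N.
  by rewrite card_ord addn1 expnS; have := cube_dim_ge n; lia.
have [x [s [x_lt s_le flow]]] := @flow_complete 'I_n (adj I) p (m + 1) adj_sym adj_conn pp
  ltac:(lia) nm ltac:(lia).
(* One pair of labellings [x], [s] serves all five sums; only the flow values differ. *)
have [phi phiP] := @fin_all_exists 'I_5 (fun _ => 'I_n -> 'F_p) (fun q phi => forall v,
   vertex_residual I (fun v => val (c1 v)) p t w
    (fun v => code valid c1 (vrank I v)) (fun v => code valid c1 (n + vrank I v))
    (fun v => code valid c1 (vrank I (perm v))) q v
    + inflow (adj I) x s phi v = outflow (adj I) x s phi v)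
   (fun q => flow _ (honest_residual c1 t w pp (ltn_ord q))).
pose labels v := [:: j, t, w, x v, s v & [seq (phi q v : nat) | q <- enum 'I_5]].
have labels_lt v : all (fun y => y < 2 ^ W)%N (labels v).
  have wl : (2 ^ index_width n <= 2 ^ W)%N.
    by rewrite leq_exp2l // /field_width /point_width /index_width; lia.
  rewrite /= (leq_trans (slice_lt _ _ _) wl) (leq_trans (slice_lt _ _ _) TW).
  rewrite (leq_trans (slice_lt _ _ _) TW) /=; apply/and3P; split.
  - by apply: leq_trans (x_lt v) _; lia.
  - by apply: leq_ltn_trans (s_le v) _; lia.
  - apply/allP => _ /mapP [q _ ->]; apply: leq_trans (ltnW pW).
    by apply: leq_trans (ltn_ord (phi q v)) _; rewrite Fp_cast.
exists (fun v => pack W (labels v)); split.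
  by move=> v; rewrite size_pack /= size_map size_enum_ord.
move=> Pr E2 E3; apply/(all_acceptP valid) ; split.
  by move=> v; rewrite E3 !field_pack.
move=> q v q5; rewrite -/coin2 -/j -/t -/w -/p.
have phi_lab u : (field_at W (pm3 Pr c1 c2 u) (5 + q))%:R = phi (Ordinal q5) u :> 'F_p.
  rewrite E3 field_pack // /labels /= (nth_map (Ordinal q5)) ?size_enum_ord //.
  by rewrite natr_Zp (nth_ord_enum (Ordinal q5) (Ordinal q5)).
have := phiP (Ordinal q5) v.
rewrite -(@eq_vertex_residual _ p t w (fun u => field_at W (pm2 Pr c1 u) 0) _
  (fun u => field_at W (pm2 Pr c1 u) 1) _ (fun u => field_at W (pm2 Pr c1 u) 2)).
- move=> H; rewrite (@eq_inflow _ _ _ _ x _ s _ (phi (Ordinal q5))) ?H.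
  + by symmetry; apply: eq_outflow => u; rewrite ?phi_lab // E3 field_pack.
  + by move=> u; rewrite E3 field_pack.
  + by move=> u; rewrite E3 field_pack.
  + exact: phi_lab.
- by move=> u; rewrite E2 field_honest2.
- by move=> u; rewrite E2 field_honest2.
- by move=> u; rewrite E2 field_honest2.
Qed.

Lemma dsym_complete : exists Pr : prover5 n L,
  prover_size_ok Pr /\ (2 * n_total n L < 3 * n_accept I Pr)%N.
Proof.
have [M3 M3P] := fin_all_exists honest3_exists.
(* The honest prover opens with an empty message and convinces all nodes for every outcome of the
   coins. *)
pose Pr := @Prover5 n L (fun _ => [::]) honest2 (fun c1 c2 => M3 (c1, c2)).
exists Pr; split.
  move=> c1 c2 v; split=> //=; last exact: (M3P (c1, c2)).1.
  by rewrite size_pack /= leq_mul2r orbT.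
rewrite /n_accept (_ : [set z | _] = setT) ?cardsT.
  rewrite /n_total ltn_mul2r andbT; apply/card_gt0P.
  by exists ([ffun=> [tuple false | _ < L]], [ffun=> [tuple false | _ < L]]).
apply/setP => -[c1 c2]; rewrite !inE; apply/forallP => v /=.
exact: ((M3P (c1, c2)).2 Pr erefl erefl v).
Qed.
End Completeness.

Theorem theorem1p5 :
  forall c : nat, exists K : nat, exists P : protocol,
    (forall n : nat, ell P n <= K * trunc_log 2 (trunc_log 2 n) + K) /\
    decides_dMAMAM c P DSym.
Proof.
(* The message length is [80 * loglog n + 400], and the 3 inside [loglog] raises the constant to
   640. *)
move=> c; exists 640, dsym_protocol; split=> [n|n I valid].
  by rewrite /= /field_width /point_width /loglog; lia.
split=> [sym|nsym Pr]; first exact: dsym_complete valid sym.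
exact: dsym_sound valid Pr nsym.
Qed.
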